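(* Let $H$ and $A$ be braided Hopf algebras with braidings $\Psi_H$ and $\Psi_A$, and let $\langle\cdot,\cdot\rangle:H\otimes A\to\mathbb K$ be a braided pairing with respect to a braiding $\Xi:H\otimes A\to A\otimes H$. Suppose that additionally $$(\mathrm{id}_A\otimes\langle\cdot,\cdot\rangle)(\Xi\otimes\mathrm{id}_A)(\mathrm{id}_H\otimes\Psi_A)=\langle\cdot,\cdot\rangle\otimes\mathrm{id}_A\quad\text{on }H\otimes A\otimes A,$$ $$(\langle\cdot,\cdot\rangle\otimes\mathrm{id}_H)(\mathrm{id}_H\otimes\Xi)(\Psi_H\otimes\mathrm{id}_A)=\mathrm{id}_H\otimes\langle\cdot,\cdot\rangle\quad\text{on }H\otimes H\otimes A.$$ Then $$\triangleright=(\mathrm{id}_A\otimes\langle\cdot,\cdot\rangle)\circ(\Xi\otimes\mathrm{id}_A)\circ(\mathrm{id}_H\otimes\Delta_A):H\otimes A\to A$$ defines a braided left action of $H$ on $A$ (with mutual braiding $\Xi$), i.e. $A$ becomes a left braided $H$-module algebra.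
   Context: All tensor products are over the ground field $\mathbb K$. A braided Hopf algebra $(H,\cdot,\Delta,S,\epsilon,\eta,\Psi)$ is a unital associative algebra and a coassociative counital coalgebra $H$ with a braiding $\Psi:H\otimes H\to H\otimes H$ such that all structure maps are compatible with $\Psi$, the coproduct and the counit are morphisms in the braided category (in particular $\Delta\circ\cdot=(\cdot\otimes\cdot)(\mathrm{id}\otimes\Psi\otimes\mathrm{id})(\Delta\otimes\Delta)$), the antipode $S$ is an antihomomorphism in the braided category ($S\circ\cdot=\cdot\circ\Psi\circ(S\otimes S)$), and the standard requirements of a Hopf algebra hold, in particular $\cdot(S\otimes\mathrm{id})\Delta=\eta\epsilon=\cdot(\mathrm{id}\otimes S)\Delta$. Braided pairing. Let $H,A$ be braided Hopf algebras and $\Xi:H\otimes A\to A\otimes H$ a braiding compatible with products and coproducts of both: $\Xi(\cdot_H\otimes\mathrm{id})=(\mathrm{id}\otimes\cdot_H)(\Xi\otimes\mathrm{id})(\mathrm{id}\otimes\Xi)$, $\Xi(\mathrm{id}\otimes\cdot_A)=(\cdot_A\otimes\mathrm{id})(\mathrm{id}\otimes\Xi)(\Xi\otimes\mathrm{id})$, $(\mathrm{id}\otimes\Delta_H)\Xi=(\Xi\otimes\mathrm{id})(\mathrm{id}\otimes\Xi)(\Delta_H\otimes\mathrm{id})$, $(\Delta_A\otimes\mathrm{id})\Xi=(\mathrm{id}\otimes\Xi)(\Xi\otimes\mathrm{id})(\mathrm{id}\otimes\Delta_A)$. A bilinear map, viewed as a linear map $\langle\cdot,\cdot\rangle:H\otimes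 A\to\mathbb K$, is a braided pairing if $\langle\cdot,\cdot\rangle(\mathrm{id}\otimes\cdot_A)=(\langle\cdot,\cdot\rangle\otimes\langle\cdot,\cdot\rangle)(\mathrm{id}\otimes\Xi\otimes\mathrm{id})(\Delta_H\otimes\mathrm{id}\otimes\mathrm{id})$ on $H\otimes A\otimes A$, $\langle\cdot,\cdot\rangle(\cdot_H\otimes\mathrm{id})=(\langle\cdot,\cdot\rangle\otimes\langle\cdot,\cdot\rangle)(\mathrm{id}\otimes\Xi\otimes\mathrm{id})(\mathrm{id}\otimes\mathrm{id}\otimes\Delta_A)$ on $H\otimes H\otimes A$, and $\langle S h,a\rangle=\langle h,Sa\rangle$ for all $h\in H$, $a\in A$. Left braided module algebra. $A$ is a left braided $H$-module algebra via a bilinear map (left action) $\triangleright:H\otimes A\to A$ and a braiding $\Xi:H\otimes A\to A\otimes H$ if (1) $\Xi(\cdot_H\otimes\mathrm{id})=(\mathrm{id}\otimes\cdot_H)(\Xi\otimes\mathrm{id})(\mathrm{id}\otimes\Xi)$; (2) $\Xi(\mathrm{id}\otimes\cdot_A)=(\cdot_A\otimes\mathrm{id})(\mathrm{id}\otimes\Xi)(\Xi\otimes\mathrm{id})$; (3) $(\mathrm{id}\otimes\Delta_H)\Xi=(\Xi\otimes\mathrm{id})(\mathrm{id}\otimes\Xi)(\Delta_H\otimes\mathrm{id})$; (4) $\triangleright(\mathrm{id}\otimes\cdot_A)=\cdot_A(\triangleright\otimes\triangleright)(\mathrm{id}\otimes\Xi\otimes\mathrm{id})(\Delta_H\otimes\mathrm{id}\otimes\mathrm{id})$;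 (5) $\triangleright(\cdot_H\otimes\mathrm{id})=\triangleright(\mathrm{id}\otimes\triangleright)$; (6) $\Xi(\mathrm{id}\otimes\triangleright)=(\triangleright\otimes\mathrm{id})(\mathrm{id}\otimes\Xi)(\Psi_H\otimes\mathrm{id})$ on $H\otimes H\otimes A$; (7) in case $H$ and $A$ are unital, $1\triangleright a=a$ and $h\triangleright1=\epsilon(h)1$.
   Formalization: The braided pairing is additionally assumed not to be identically zero: the zero pairing satisfies every stated hypothesis, but then ▷ = 0 and the unit condition 1▷a = a fails. *)

(* Defs.v *)
From HB Require Import structures.
From mathcomp Require Import all_boot all_algebra.
From mathcomp Require Import generic_quotient ring_quotient sesquilinear.
From mathcomp Require Import finmap boolp.
From mathcomp Require Import monalg.

Set Implicit Arguments.
Unset Strict Implicit.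
Unset Printing Implicit Defensive.

Import GRing.Theory.
Import Quotient.Exports.

Local Open Scope ring_scope.
Local Open Scope quotient_scope.

Reserved Notation "U ⊗ V" (at level 40, V at level 40, right associativity).
Reserved Notation "u ⊗ₜ v" (at level 40, v at level 40, right associativity).
Reserved Notation "f \ox g" (at level 40, left associativity).

Section TensorConstruction.
Variables (K : fieldType) (U V : lmodType K).

(* U ⊗ V is the quotient of the free module on the set U * V by the submodule
   generated by the bilinearity relations. *)
Inductive bilin_rel : {malg K[(U * V)%type]} -> Prop :=
| bilin_rel0 : bilin_rel 0
| bilin_relP a x y : bilin_rel x -> bilin_rel y -> bilin_rel (a *: x + y)
| bilin_rell a u u' v :
    bilin_rel (<< (a *: u + u', v) >> - (a *: << (u, v) >> + << (u', v) >>))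
| bilin_relr a u v v' :
    bilin_rel (<< (u, a *: v + v') >> - (a *: << (u, v) >> + << (u, v') >>)).

Definition bilin_relb : {pred {malg K[(U * V)%type]}} := fun x => `[< bilin_rel x >].

Fact bilin_relb_zmod : zmod_closed bilin_relb.
Proof.
split=> [|x y]; first by apply/asboolP/bilin_rel0.
move=> /asboolP xN /asboolP yN; apply/asboolP.
by rewrite addrC -scaleN1r; apply: bilin_relP.
Qed.
HB.instance Definition _ :=
  GRing.isZmodClosed.Build {malg K[(U * V)%type]} bilin_relb bilin_relb_zmod.

Definition tensor : Type := Quotient.quot bilin_relb.

HB.instance Definition _ := GRing.Zmodule.on tensor.
HB.instance Definition _ :=
  EqQuotient.copy tensor (Quotient.quot bilin_relb).

Lemma tensor_piP (x y : {malg K[(U * V)%type]}) :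
  (\pi_tensor x = \pi_tensor y) <-> bilin_rel (x - y).
Proof.
split=> [/eqP|h]; last by apply/eqP; rewrite -Quotient.idealrBE; exact/asboolP.
rewrite -Quotient.idealrBE => ?; exact/asboolP.
Qed.

Lemma tensor_piD (x y : {malg K[(U * V)%type]}) :
  \pi_tensor (x + y) = \pi_tensor x + \pi_tensor y.
Proof. exact: (Quotient.pi_add bilin_relb). Qed.

Definition tscale (a : K) (t : tensor) : tensor := \pi_tensor (a *: repr t).

Lemma tensor_piZ a (x : {malg K[(U * V)%type]}) :
  \pi_tensor (a *: x) = tscale a (\pi_tensor x).
Proof.
apply/tensor_piP; rewrite -scalerBr -[X in bilin_rel X]addr0.
apply: bilin_relP; last exact: bilin_rel0.
by apply/tensor_piP; rewrite reprK.
Qed.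

Fact tscaleA a b t : tscale a (tscale b t) = tscale (a * b) t.
Proof. by rewrite -[t]reprK -(tensor_piZ b) -(tensor_piZ a) scalerA tensor_piZ. Qed.
Fact tscale1 : left_id 1 tscale.
Proof. by move=> t; rewrite -[t]reprK -!tensor_piZ scale1r. Qed.
Fact tscaleDr : right_distributive tscale +%R.
Proof.
move=> a t t'; rewrite -[t]reprK -[t']reprK -tensor_piD -!tensor_piZ.
by rewrite scalerDr tensor_piD.
Qed.
Fact tscaleDl t : {morph tscale^~ t : a b / a + b}.
Proof. by move=> a b; rewrite -[t]reprK -!tensor_piZ scalerDl tensor_piD. Qed.

HB.instance Definition _ := GRing.Zmodule_isLmodule.Build K tensor
  tscaleA tscale1 tscaleDr tscaleDl.

Lemma tensor_pi_linear a (x y : {malg K[(U * V)%type]}) :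
  \pi_tensor (a *: x + y) = a *: (\pi_tensor x : tensor) + \pi_tensor y.
Proof. by rewrite tensor_piD tensor_piZ. Qed.

Definition tpure (u : U) (v : V) : tensor := \pi_tensor << (u, v) >>.

Fact tpure_bilinear : bilinear_for *:%R *:%R tpure.
Proof.
split=> [v a u u'|u a v v']; apply: etrans (tensor_pi_linear _ _ _);
  apply/tensor_piP; [exact: bilin_rell | exact: bilin_relr].
Qed.
HB.instance Definition _ :=
  bilinear_isBilinear.Build K U V tensor *:%R *:%R tpure tpure_bilinear.

End TensorConstruction.

Notation "U ⊗ V" := (tensor U V) : type_scope.
Notation "U ⊗ V" := (tensor U V) : ring_scope.
Notation "u ⊗ₜ v" := (tpure u v) : ring_scope.

Section UniversalProperty.
Variables (K : fieldType) (U V W : lmodType K).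

Definition free_lift (f : U -> V -> W) (x : {malg K[(U * V)%type]}) : W :=
  \sum_(k <- msupp x) x@_k *: f k.1 k.2.

Lemma free_liftEw f (d : {fset (U * V)%type}) x : (msupp x `<=` d)%fset ->
  free_lift f x = \sum_(k <- d) x@_k *: f k.1 k.2.
Proof.
move=> xd; rewrite /free_lift (big_fset_incl _ xd) // => k _ kx.
by rewrite mcoeff_outdom // scale0r.
Qed.

Lemma free_lift_linear f : linear (free_lift f).
Proof.
move=> a x y.
set d := (msupp (a *: x + y) `|` msupp x `|` msupp y)%fset.
have dxy : (msupp (a *: x + y) `<=` d)%fset.
  by rewrite /d -fsetUA fsubsetUl.
have dx : (msupp x `<=` d)%fset.
  by rewrite /d fsetUAC fsubsetUr.
have dy : (msupp y `<=` d)%fset by rewrite /d fsubsetUr.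
rewrite (free_liftEw _ dxy) (free_liftEw _ dx) (free_liftEw _ dy).
rewrite scaler_sumr -big_split /=; apply: eq_bigr => k _.
by rewrite mcoeffD mcoeffZ scalerDl scalerA.
Qed.
HB.instance Definition _ f :=
  GRing.isLinear.Build K {malg K[(U * V)%type]} W *:%R (free_lift f)
    (free_lift_linear f).

Lemma free_liftU f k : free_lift f << k >> = f k.1 k.2.
Proof.
rewrite (@free_liftEw _ [fset k]%fset) ?msuppU_le // big_seq_fset1.
by rewrite mcoeffUU scale1r.
Qed.

Definition tlift (f : {bilinear U -> V -> W}) (t : U ⊗ V) : W :=
  free_lift f (repr t).

Lemma tlift_pi (f : {bilinear U -> V -> W}) x :
  tlift f (\pi x) = free_lift f x.
Proof.
suff null y : bilin_rel y -> free_lift f y = 0.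
  apply/eqP; rewrite -subr_eq0 /tlift -linearB; apply/eqP/null.
  by apply/tensor_piP; rewrite reprK.
elim=> {y} [|a y z _ y0 _ z0|a u u' v|a u v v'].
- by rewrite linear0.
- by rewrite linearP /= y0 z0 scaler0 addr0.
- by rewrite linearB linearP /= !free_liftU /= linearPl subrr.
- by rewrite linearB linearP /= !free_liftU /= linearPr subrr.
Qed.

Fact tlift_linear (f : {bilinear U -> V -> W}) : linear (tlift f).
Proof.
move=> a s t; rewrite -[s]reprK -[t]reprK.
by rewrite -tensor_pi_linear !tlift_pi linearP.
Qed.
HB.instance Definition _ (f : {bilinear U -> V -> W}) :=
  GRing.isLinear.Build K (U ⊗ V) W *:%R (tlift f) (tlift_linear f).

Lemma tliftE (f : {bilinear U -> V -> W}) u v : tlift f (u ⊗ₜ v) = f u v.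
Proof. by rewrite tlift_pi free_liftU. Qed.

Lemma tlift_param_linear (X : lmodType K) (F : X -> {bilinear U -> V -> W}) :
  (forall u v, linear (fun x => F x u v)) ->
  forall t, linear (fun x => tlift (F x) t).
Proof.
move=> linF t a x y; rewrite /tlift /free_lift scaler_sumr -big_split /=.
by apply: eq_bigr => k _; rewrite linF scalerDr !scalerA mulrC.
Qed.

Lemma tensor_ext (f g : {linear U ⊗ V -> W}) :
  (forall u v, f (u ⊗ₜ v) = g (u ⊗ₜ v)) -> f =1 g.
Proof.
move=> fg t; rewrite -[t]reprK [repr t]monalgE.
elim/big_rec: _ => [|k x _ ih].
  have -> : \pi_(U ⊗ V) 0 = 0.
    by have := tensor_piZ 0 (0 : {malg K[(U * V)%type]}); rewrite scale0r => ->; apply: scale0r.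
  by rewrite !linear0.
have -> : << (repr t)@_k *g k >> = (repr t)@_k *: << k >> :> {malg K[(U * V)%type]}.
  by apply/malgP=> l; rewrite mcoeffZ !mcoeffU mulrnAr mulr1.
rewrite tensor_pi_linear.
by rewrite !linearP ih; case: k => u v; rewrite fg.
Qed.

End UniversalProperty.

#[global] Opaque tensor tpure tlift.

Section TensorOfMaps.
Variables (K : fieldType) (U U' V V' : lmodType K).
Variables (f : {linear U -> U'}) (g : {linear V -> V'}).

Definition tmap_bilin (u : U) (v : V) : U' ⊗ V' := f u ⊗ₜ g v.

Fact tmap_bilinear : bilinear_for *:%R *:%R tmap_bilin.
Proof.
by split=> [v a u u'|u a v v']; rewrite /tmap_bilin linearP ?linearPl ?linearPr.
Qed.
HB.instance Definition _ :=
  bilinear_isBilinear.Build K U V (U' ⊗ V') *:%R *:%R tmap_bilin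
    tmap_bilinear.

Definition tmap : {linear U ⊗ V -> U' ⊗ V'} := tlift tmap_bilin.

Lemma tmapE u v : tmap (u ⊗ₜ v) = f u ⊗ₜ g v.
Proof. exact: tliftE. Qed.

End TensorOfMaps.

Notation "f \ox g" := (tmap f g) : ring_scope.

Section Associator.
Variables (K : fieldType) (U V W : lmodType K).

Definition tassoc3 (w : W) (u : U) (v : V) : U ⊗ (V ⊗ W) := u ⊗ₜ (v ⊗ₜ w).

Fact tassoc3_bilinear w : bilinear_for *:%R *:%R (tassoc3 w).
Proof.
by split=> [v a u u'|u a v v']; rewrite /tassoc3 ?linearPl ?linearPr.
Qed.
HB.instance Definition _ w :=
  bilinear_isBilinear.Build K U V (U ⊗ (V ⊗ W)) *:%R *:%R (tassoc3 w)
    (tassoc3_bilinear w).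

Definition tassoc2 (t : U ⊗ V) (w : W) : U ⊗ (V ⊗ W) := tlift (tassoc3 w) t.

Fact tassoc2_bilinear : bilinear_for *:%R *:%R tassoc2.
Proof.
split=> [w a t t'|t a w w']; rewrite /tassoc2; first exact: linearP.
by apply: (tlift_param_linear _ t) => u v b x y; rewrite /= /tassoc3 !linearPr.
Qed.
HB.instance Definition _ :=
  bilinear_isBilinear.Build K (U ⊗ V) W (U ⊗ (V ⊗ W)) *:%R *:%R
    tassoc2 tassoc2_bilinear.

Definition tassoc : {linear (U ⊗ V) ⊗ W -> U ⊗ (V ⊗ W)} := tlift tassoc2.

Lemma tassocE u v w : tassoc ((u ⊗ₜ v) ⊗ₜ w) = u ⊗ₜ (v ⊗ₜ w).
Proof. apply: etrans; [exact: tliftE | exact: tliftE]. Qed.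

Definition tassocV3 (u : U) (v : V) (w : W) : (U ⊗ V) ⊗ W := (u ⊗ₜ v) ⊗ₜ w.

Fact tassocV3_bilinear u : bilinear_for *:%R *:%R (tassocV3 u).
Proof.
by split=> [w a v v'|v a w w']; rewrite /tassocV3 ?linearPr ?linearPl.
Qed.
HB.instance Definition _ u :=
  bilinear_isBilinear.Build K V W ((U ⊗ V) ⊗ W) *:%R *:%R (tassocV3 u)
    (tassocV3_bilinear u).

Definition tassocV2 (u : U) (t : V ⊗ W) : (U ⊗ V) ⊗ W := tlift (tassocV3 u) t.

Fact tassocV2_bilinear : bilinear_for *:%R *:%R tassocV2.
Proof.
split=> [t a u u'|u a t t']; rewrite /tassocV2; last exact: linearP.
by apply: (tlift_param_linear _ t) => v w b x y; rewrite /= /tassocV3 !linearPl.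
Qed.
HB.instance Definition _ :=
  bilinear_isBilinear.Build K U (V ⊗ W) ((U ⊗ V) ⊗ W) *:%R *:%R
    tassocV2 tassocV2_bilinear.

Definition tassocV : {linear U ⊗ (V ⊗ W) -> (U ⊗ V) ⊗ W} := tlift tassocV2.

Lemma tassocVE u v w : tassocV (u ⊗ₜ (v ⊗ₜ w)) = (u ⊗ₜ v) ⊗ₜ w.
Proof. apply: etrans; [exact: tliftE | exact: tliftE]. Qed.

End Associator.

Section Unitors.
Variables (K : fieldType) (U : lmodType K).

Definition tunitl_bilin (a : K^o) (u : U) : U := (a : K) *: u.

Fact tunitl_bilinear : bilinear_for *:%R *:%R tunitl_bilin.
Proof.
split=> [u a b b'|b a u u']; rewrite /tunitl_bilin.
  by rewrite /= scalerDl scalerA.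
by rewrite /= scalerDr !scalerA mulrC.
Qed.
HB.instance Definition _ :=
  bilinear_isBilinear.Build K K^o U U *:%R *:%R tunitl_bilin tunitl_bilinear.

Definition tunitl : {linear K^o ⊗ U -> U} := tlift tunitl_bilin.

Lemma tunitlE a u : tunitl (a ⊗ₜ u) = (a : K) *: u.
Proof. exact: tliftE. Qed.

Definition tunitr_bilin (u : U) (a : K^o) : U := (a : K) *: u.

Fact tunitr_bilinear : bilinear_for *:%R *:%R tunitr_bilin.
Proof.
split=> [b a u u'|u a b b']; rewrite /tunitr_bilin.
  by rewrite /= scalerDr !scalerA mulrC.
by rewrite /= scalerDl scalerA.
Qed.
HB.instance Definition _ :=
  bilinear_isBilinear.Build K U K^o U *:%R *:%R tunitr_bilin tunitr_bilinear.

Definition tunitr : {linear U ⊗ K^o -> U} := tlift tunitr_bilin.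

Lemma tunitrE u a : tunitr (u ⊗ₜ a) = (a : K) *: u.
Proof. exact: tliftE. Qed.

End Unitors.

Section Product.
Variables (K : fieldType) (A : algType K).

Fact mulr_bilinear : bilinear_for *:%R *:%R (@GRing.mul A).
Proof.
split=> [y a x x'|x a y y'].
  by rewrite /= mulrDl scalerAl.
by rewrite /= mulrDr scalerAr.
Qed.
HB.instance Definition _ :=
  bilinear_isBilinear.Build K A A A *:%R *:%R (@GRing.mul A) mulr_bilinear.

Definition tmul : {linear A ⊗ A -> A} := tlift (@GRing.mul A).

Lemma tmulE x y : tmul (x ⊗ₜ y) = x * y.
Proof. exact: tliftE. Qed.

End Product.

Arguments tassoc {K U V W}.
Arguments tassocV {K U V W}.
Arguments tunitl {K U}.
Arguments tunitr {K U}.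
Arguments tmul {K A}.

(* [tleft W f] is f ⊗ id_W on U ⊗ (V ⊗ W) and [tmid X Y f] is id ⊗ f ⊗ id
   on (X ⊗ U) ⊗ (V ⊗ Y), up to the associators. *)
Definition tleft (K : fieldType) (U V U' V' W : lmodType K)
    (f : {linear U ⊗ V -> U' ⊗ V'}) :
    {linear U ⊗ (V ⊗ W) -> U' ⊗ (V' ⊗ W)} :=
  tassoc \o (f \ox @idfun W) \o tassocV.

Definition tmid (K : fieldType) (U V U' V' X Y : lmodType K)
    (f : {linear U ⊗ V -> U' ⊗ V'}) :
    {linear (X ⊗ U) ⊗ (V ⊗ Y) -> (X ⊗ U') ⊗ (V' ⊗ Y)} :=
  tassocV \o (@idfun X \ox tleft Y f) \o tassoc.

Section BraidingAxioms.
Variables (K : fieldType) (U V : lmodType K) (Xi : {linear U ⊗ V -> V ⊗ U}).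

Definition braid_mull (m : {linear U ⊗ U -> U}) :=
  Xi \o (m \ox @idfun V) \o tassocV
    =1 (@idfun V \ox m) \o tleft U Xi \o (@idfun U \ox Xi).

Definition braid_mulr (m : {linear V ⊗ V -> V}) :=
  Xi \o (@idfun U \ox m)
    =1 (m \ox @idfun U) \o tassocV \o (@idfun V \ox Xi) \o tleft V Xi.

Definition braid_coprodl (d : {linear U -> U ⊗ U}) :=
  (@idfun V \ox d) \o Xi
    =1 tleft U Xi \o (@idfun U \ox Xi) \o tassoc \o (d \ox @idfun V).

Definition braid_coprodr (d : {linear V -> V ⊗ V}) :=
  tassoc \o (d \ox @idfun U) \o Xi
    =1 (@idfun V \ox Xi) \o tleft V Xi \o (@idfun U \ox d).

End BraidingAxioms.

Definition yang_baxter (K : fieldType) (U : lmodType K)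
    (Psi : {linear U ⊗ U -> U ⊗ U}) :=
  tleft U Psi \o (@idfun U \ox Psi) \o tleft U Psi
    =1 (@idfun U \ox Psi) \o tleft U Psi \o (@idfun U \ox Psi).

HB.mixin Record Algebra_isBraidedHopf (K : fieldType) H of GRing.Algebra K H := {
  coprod : {linear H -> H ⊗ H};
  counit : {linear H -> K^o};
  antipode : {linear H -> H};
  braid : {linear H ⊗ H -> H ⊗ H};
  coprodA : tassoc \o (coprod \ox @idfun H) \o coprod
              =1 (@idfun H \ox coprod) \o coprod;
  counitl : tunitl \o (counit \ox @idfun H) \o coprod =1 id;
  counitr : tunitr \o (@idfun H \ox counit) \o coprod =1 id;
  braid_bij : bijective braid;
  braid_yang_baxter : yang_baxter braid;
  braidMl : braid_mull braid tmul;
  braidMr : braid_mulr braid tmul;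
  braid1l : forall x : H, braid (1 ⊗ₜ x) = x ⊗ₜ 1;
  braid1r : forall x : H, braid (x ⊗ₜ 1) = 1 ⊗ₜ x;
  braid_coprodL : braid_coprodl braid coprod;
  braid_coprodR : braid_coprodr braid coprod;
  braid_counitl : tunitr \o (@idfun H \ox counit) \o braid
                    =1 tunitl \o (counit \ox @idfun H);
  braid_counitr : tunitl \o (counit \ox @idfun H) \o braid
                    =1 tunitr \o (@idfun H \ox counit);
  braid_antipodel : braid \o (antipode \ox @idfun H)
                      =1 (@idfun H \ox antipode) \o braid;
  braid_antipoder : braid \o (@idfun H \ox antipode)
                      =1 (antipode \ox @idfun H) \o braid;
  coprodM : coprod \o tmul
              =1 (tmul \ox tmul) \o tmid H H braid \o (coprod \ox coprod);
  coprod1 : coprod 1 = 1 ⊗ₜ 1;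
  counitM : forall x y : H, counit (x * y) = (counit x : K) * counit y;
  counit1 : counit 1 = 1;
  antipodeM : antipode \o tmul =1 tmul \o braid \o (antipode \ox antipode);
  antipodel : forall x : H, (tmul \o (antipode \ox @idfun H) \o coprod) x
                              = (counit x : K)%:A;
  antipoder : forall x : H, (tmul \o (@idfun H \ox antipode) \o coprod) x
                              = (counit x : K)%:A
}.

#[short(type="braidedHopfType")]
HB.structure Definition BraidedHopf (K : fieldType) :=
  { H of GRing.Algebra K H & Algebra_isBraidedHopf K H }.

Section BraidedPairing.
Variables (K : fieldType) (H A : braidedHopfType K).
Variable Xi : {linear H ⊗ A -> A ⊗ H}.

(* A braiding is invertible. Together with the compatibility conditions this
   forces Xi (h ⊗ₜ 1) = 1 ⊗ₜ h, Xi (1 ⊗ₜ a) = a ⊗ₜ 1 and the analogous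
   identities for the counits, so these are not required separately. *)
Record mutual_braiding : Prop := MutualBraiding {
  mutual_bij : bijective Xi;
  mutual_mull : braid_mull Xi tmul;
  mutual_mulr : braid_mulr Xi tmul;
  mutual_coprodl : braid_coprodl Xi coprod;
  mutual_coprodr : braid_coprodr Xi coprod
}.

(* The zero form satisfies these conditions; a nonzero pairing is automatically
   unital: pr (h ⊗ₜ 1) = counit h and pr (1 ⊗ₜ a) = counit a. *)
Record braided_pairing (pr : {linear H ⊗ A -> K^o}) : Prop := BraidedPairing {
  pairing_mulr : pr \o (@idfun H \ox tmul)
    =1 tunitl \o (pr \ox pr) \o tmid H A Xi \o (coprod \ox @idfun (A ⊗ A));
  pairing_mull : pr \o (tmul \ox @idfun A)
    =1 tunitl \o (pr \ox pr) \o tmid H A Xi \o (@idfun (H ⊗ H) \ox coprod);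
  pairing_antipode : forall (h : H) (a : A),
    pr (antipode h ⊗ₜ a) = pr (h ⊗ₜ antipode a)
}.

End BraidedPairing.

Record braided_module_algebra (K : fieldType) (H : braidedHopfType K)
    (A : algType K) (act : {linear H ⊗ A -> A})
    (Xi : {linear H ⊗ A -> A ⊗ H}) : Prop := BraidedModuleAlgebra {
  modalg_bij : bijective Xi;
  modalg_braid_mull : braid_mull Xi tmul;
  modalg_braid_mulr : braid_mulr Xi tmul;
  modalg_braid_coprod : braid_coprodl Xi coprod;
  modalg_actMr : act \o (@idfun H \ox tmul)
    =1 tmul \o (act \ox act) \o tmid H A Xi \o (coprod \ox @idfun (A ⊗ A));
  modalg_actMl : act \o (tmul \ox @idfun A) \o tassocV
    =1 act \o (@idfun H \ox act);
  modalg_braid_act : Xi \o (@idfun H \ox act)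
    =1 (act \ox @idfun H) \o tassocV \o (@idfun H \ox Xi) \o tleft A braid;
  modalg_act1l : forall a : A, act (1 ⊗ₜ a) = a;
  modalg_act1r : forall h : H, act (h ⊗ₜ 1) = (counit h : K)%:A
}.

Definition pairing_act (K : fieldType) (H A : braidedHopfType K)
    (Xi : {linear H ⊗ A -> A ⊗ H}) (pr : {linear H ⊗ A -> K^o}) :
    {linear H ⊗ A -> A} :=
  tunitr \o (@idfun A \ox pr) \o tleft A Xi \o (@idfun H \ox coprod).

(* Main.v *)
(* Proof idea. In Sweedler notation the axiom h |> (g |> a) = (h g) |> a and the
   unit axioms follow directly from the pairing axioms; a nonzero pairing is
   unital because <1, -> and <-, 1> are convolution-idempotent algebra maps,
   hence counits.  The two remaining axioms, for h |> (a b) and for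
   Xi(h ⊗ (g |> a)), need the extra hypotheses on the pairing together with the
   mixed Yang-Baxter equations relating Xi to Psi_A and to Psi_H.  The latter
   are not assumed: since
     Psi(a ⊗ b) = S(a_1) (a_2 b_1)_1 ⊗ (a_2 b_1)_2 S(b_2),
   they hold as soon as Xi commutes with products, coproducts and antipodes, and
   it commutes with the antipodes by uniqueness of convolution inverses. *)

Require Import Defs.
From HB Require Import structures.
From mathcomp Require Import all_boot all_algebra.

Set Implicit Arguments.
Unset Strict Implicit.
Unset Printing Implicit Defensive.

Import GRing.Theory.
Local Open Scope ring_scope.

(** * Sweedler sums *)

(* The sum of [k u v] over a chosen decomposition of [t] into pure tensors
   [u ⊗ₜ v]; it is independent of the choice only when [k] is bilinear. *)
HB.lock Definition tsum (K : fieldType) (U V W : lmodType K) (t : U ⊗ V)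
  (k : U -> V -> W) : W := free_lift k (generic_quotient.repr t).

Notation "\tsum_ ( u , v <- t ) E" := (tsum t (fun u v => E))
  (at level 41, E at level 41, u name, v name, t at level 50,
   format "'[' \tsum_ ( u ,  v  <-  t ) '/  '  E ']'") : ring_scope.

Section Calculus.
Variables (K : fieldType) (U V W : lmodType K).

Definition bilin (k : U -> V -> W) : Prop :=
  (forall v, linear (fun u => k u v)) /\ (forall u, linear (fun v => k u v)).

Lemma eq_tsum (t : U ⊗ V) (k k' : U -> V -> W) :
  (forall u v, k u v = k' u v) -> tsum t k = tsum t k'.
Proof. by move=> kk; rewrite tsum.unlock; apply: eq_bigr => p _; rewrite kk. Qed.

(** The bridge to the universal property: for bilinear [k], sums over the chosen decomposition are
    the values of a linear map on the tensor product, hence independent of the choice. *)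
Lemma bilin_tlift (k : U -> V -> W) : bilin k ->
  exists f : {linear U ⊗ V -> W}, (forall u v, f (u ⊗ₜ v) = k u v) /\
    (forall t, f t = tsum t k).
Proof.
move=> [kl kr].
have kP : bilinear_for *:%R *:%R k by split=> [v|u]; [exact: kl | exact: kr].
pose kM := bilinear_isBilinear.Build K U V W *:%R *:%R k kP.
pose F : {bilinear U -> V -> W} := HB.pack k kM.
exists (tlift F); split=> [u v|t]; first exact: (tliftE F u v).
by rewrite tsum.unlock.
Qed.

Lemma tsum_pure (k : U -> V -> W) u v : bilin k -> tsum (u ⊗ₜ v) k = k u v.
Proof. by move=> /bilin_tlift[f [fE fT]]; rewrite -fT fE. Qed.

Lemma linear_tsum_l (k : U -> V -> W) : bilin k -> linear (fun t => tsum t k).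
Proof.
by move=> /bilin_tlift[f [_ fT]] a s t; rewrite -!fT linearP.
Qed.

End Calculus.

Lemma linear_tsum (K : fieldType) (U V W X : lmodType K)
    (f : {linear W -> X}) (t : U ⊗ V) (k : U -> V -> W) :
  f (tsum t k) = \tsum_(u, v <- t) f (k u v).
Proof.
by rewrite tsum.unlock /free_lift linear_sum; apply: eq_bigr => p _; rewrite linearZ.
Qed.

(** Summing pure tensors is a linear map that agrees with the identity on pure tensors. Read from
    right to left, it closes a Sweedler computation into an actual tensor. *)
Lemma tensorE (K : fieldType) (U V : lmodType K) (t : U ⊗ V) :
  t = \tsum_(u, v <- t) u ⊗ₜ v.
Proof.
have bp : bilin (@tpure K U V).
  by split=> [v|u] a x y; rewrite ?linearPl ?linearPr.
have [f [fE fT]] := bilin_tlift bp.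
rewrite -[RHS]fT; symmetry.
exact: (@tensor_ext _ _ _ _ f idfun).
Qed.

Lemma linear_tsumE (K : fieldType) (U V W : lmodType K)
    (f : {linear U ⊗ V -> W}) t :
  f t = \tsum_(u, v <- t) f (u ⊗ₜ v).
Proof. by rewrite {1}[t]tensorE linear_tsum. Qed.

Lemma tsumZ (K : fieldType) (U V W : lmodType K) (c : K) (t : U ⊗ V)
    (k : U -> V -> W) :
  c *: tsum t k = \tsum_(u, v <- t) c *: k u v.
Proof. exact: (linear_tsum ( *:%R c)). Qed.

(** Fubini for finite sums over fixed representatives; the two scalar coefficients commute in
    [K]. *)
Lemma exchange_tsum (K : fieldType) (U V X Y W : lmodType K)
    (s : U ⊗ V) (t : X ⊗ Y) (k : U -> V -> X -> Y -> W) :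
  \tsum_(u, v <- s) \tsum_(x, y <- t) k u v x y =
  \tsum_(x, y <- t) \tsum_(u, v <- s) k u v x y.
Proof.
rewrite tsum.unlock /free_lift.
under eq_bigr do rewrite scaler_sumr.
rewrite exchange_big; apply: eq_bigr => p _.
by rewrite scaler_sumr; apply: eq_bigr => q _; rewrite !scalerA mulrC.
Qed.

Lemma tsum_tsum (K : fieldType) (U V X Y W : lmodType K) (s : U ⊗ V)
    (g : U -> V -> X ⊗ Y) (k : X -> Y -> W) : bilin k ->
  tsum (\tsum_(u, v <- s) g u v) k = \tsum_(u, v <- s) tsum (g u v) k.
Proof.
move=> /bilin_tlift[f [_ fT]]; rewrite -fT linear_tsum.
by apply: eq_tsum => u v; rewrite fT.
Qed.

(** * Closure rules for linearity of unbundled functions *)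

Section LinearityRules.
Variables (K : fieldType) (U V W X Y : lmodType K).

Lemma lin_comp (g : {linear V -> W}) (f : U -> V) :
  linear f -> linear (fun x => g (f x)).
Proof. by move=> fl a x y; rewrite fl linearP. Qed.

Lemma lin_compf (g : V -> W) (f : U -> V) :
  linear g -> linear f -> linear (fun x => g (f x)).
Proof. by move=> gl fl a x y; rewrite fl gl. Qed.

Lemma lin_tpurel (f : U -> V) (w : W) :
  linear f -> linear (fun x => f x ⊗ₜ w).
Proof. by move=> fl a x y; rewrite fl linearPl. Qed.

Lemma lin_tpurer (f : U -> V) (w : W) :
  linear f -> linear (fun x => w ⊗ₜ f x).
Proof. by move=> fl a x y; rewrite fl linearPr. Qed.

Lemma lin_scaler (f : U -> V) (c : K) :
  linear f -> linear (fun x => c *: f x).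
Proof. by move=> fl a x y; rewrite fl scalerDr !scalerA mulrC. Qed.

Lemma lin_scalel (f : U -> K^o) (v : V) :
  linear f -> linear (fun x => (f x : K) *: v).
Proof. by move=> fl a x y; rewrite fl scalerDl scalerA. Qed.

Lemma lin_mull (A : algType K) (f : U -> A) (c : A) :
  linear f -> linear (fun x => f x * c).
Proof. by move=> fl a x y; rewrite fl mulrDl scalerAl. Qed.

Lemma lin_mulr (A : algType K) (f : U -> A) (c : A) :
  linear f -> linear (fun x => c * f x).
Proof. by move=> fl a x y; rewrite fl mulrDr scalerAr. Qed.

Lemma lin_tsuml (f : U -> X ⊗ Y) (k : X -> Y -> W) :
  linear f -> bilin k -> linear (fun x => tsum (f x) k).
Proof. by move=> fl kb a x y; rewrite fl; apply: linear_tsum_l. Qed.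

Lemma lin_tsumr (t : X ⊗ Y) (k : U -> X -> Y -> W) :
  (forall u v, linear (fun x => k x u v)) -> linear (fun x => tsum t (k x)).
Proof.
move=> kl a x y; rewrite tsum.unlock /free_lift scaler_sumr -big_split /=.
by apply: eq_bigr => p _; rewrite kl scalerDr !scalerA mulrC.
Qed.

Lemma lin_id : linear (fun x : U => x).
Proof. by []. Qed.

End LinearityRules.

Definition trilin (K : fieldType) (U V W X : lmodType K)
    (k : U -> V -> W -> X) : Prop :=
  [/\ forall v w, linear (fun u => k u v w),
      forall u w, linear (fun v => k u v w)
    & forall u v, linear (fun w => k u v w)].

(* In the patterns below the binder is anonymous so that [?w] only matches
   terms in which the bound variable does not occur. *)
Ltac lin :=
  cbv beta;
  lazymatch goal with
  | |- bilin _ => first [assumption | split=> ?; lin]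
  | |- trilin _ => first [assumption | split=> ? ?; lin]
  | |- GRing.linear_for _ (fun x => x) => exact: lin_id
  | |- GRing.linear_for _ idfun => exact: lin_id
  | |- GRing.linear_for _ (fun _ => tsum ?t _) =>
      apply: lin_tsumr => ? ?; lin
  | |- GRing.linear_for _ (fun _ => tsum _ _) => apply: lin_tsuml; lin
  | |- GRing.linear_for _ (fun _ => _ ⊗ₜ ?w) => apply: lin_tpurel; lin
  | |- GRing.linear_for _ (fun _ => ?w ⊗ₜ _) => apply: lin_tpurer; lin
  | |- GRing.linear_for _ (tpure ?w) => apply: lin_tpurer; lin
  | |- GRing.linear_for _ (fun _ => GRing.mul _ ?w) => apply: lin_mull; lin
  | |- GRing.linear_for _ (fun _ => GRing.mul ?w _) => apply: lin_mulr; lin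
  | |- GRing.linear_for _ (GRing.mul ?w) => apply: lin_mulr; lin
  | |- GRing.linear_for _ (fun _ => GRing.scale ?w _) => apply: lin_scaler; lin
  | |- GRing.linear_for _ (fun _ => GRing.scale _ ?w) => apply: lin_scalel; lin
  | |- GRing.linear_for _ (GRing.scale ?w) => apply: lin_scaler; lin
  | |- GRing.linear_for _ (fun _ => GRing.Linear.sort _ _) => apply: lin_comp; lin
  | |- GRing.linear_for _ (GRing.Linear.sort ?f) => exact: linearP
  | |- GRing.linear_for _ _ => first [by auto | lin_app]
  end
with lin_app :=
  lazymatch goal with
  | |- GRing.linear_for _ (fun _ => ?g _) =>
    lazymatch goal with |- GRing.linear_for _ (fun x => _ (@?f x)) =>
      apply: (@lin_compf _ _ _ _ g f); [by auto | lin] end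
  | |- GRing.linear_for _ (fun _ => ?g _ ?a) =>
    lazymatch goal with |- GRing.linear_for _ (fun x => _ (@?f x) _) =>
      apply: (@lin_compf _ _ _ _ (fun y => g y a) f); [by auto | lin] end
  | |- GRing.linear_for _ (fun _ => ?g _ ?a ?b) =>
    lazymatch goal with |- GRing.linear_for _ (fun x => _ (@?f x) _ _) =>
      apply: (@lin_compf _ _ _ _ (fun y => g y a b) f); [by auto | lin] end
  end.

(** Lets a lambda term proved linear, such as a context of several nested maps, inherit the lemmas
    on bundled linear maps. *)
Lemma linear_pack (K : fieldType) (U V : lmodType K) (g : U -> V) :
  linear g -> exists f : {linear U -> V}, (f : U -> V) = g.
Proof.
move=> gl; pose gM := GRing.isLinear.Build K U V *:%R g gl.
pose f : {linear U -> V} := HB.pack g gM.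
by exists f.
Qed.

Lemma linear_scale (K : fieldType) (U V : lmodType K) (g : U -> V) c u :
  linear g -> g (c *: u) = c *: g u.
Proof. by move=> /linear_pack[f <-]; rewrite linearZ. Qed.

Lemma tsum_scale (K : fieldType) (U V W : lmodType K) c (t : U ⊗ V)
    (k : U -> V -> W) : bilin k -> tsum (c *: t) k = c *: tsum t k.
Proof. by move=> /linear_tsum_l/linear_scale. Qed.

Lemma tensor_expand (K : fieldType) (U V W : lmodType K) (g : U ⊗ V -> W) t :
  linear g -> g t = \tsum_(u, v <- t) g (u ⊗ₜ v).
Proof. by move=> /linear_pack[f <-]; exact: linear_tsumE. Qed.

Lemma tsum_push (K : fieldType) (U V W X : lmodType K) (g : W -> X) (t : U ⊗ V)
    (k : U -> V -> W) :
  linear g -> g (tsum t k) = \tsum_(u, v <- t) g (k u v).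
Proof. by move=> /linear_pack[f <-]; exact: linear_tsum. Qed.

Lemma tensor_ext3 (K : fieldType) (U V W X : lmodType K)
    (f g : U ⊗ (V ⊗ W) -> X) :
  linear f -> linear g ->
  (forall u v w, f (u ⊗ₜ (v ⊗ₜ w)) = g (u ⊗ₜ (v ⊗ₜ w))) -> f =1 g.
Proof.
move=> fl gl fg t; rewrite (tensor_expand t fl) (tensor_expand t gl).
apply: eq_tsum => u s.
rewrite (@tensor_expand _ _ _ _ (fun s => f (u ⊗ₜ s))); last first.
  by move=> a x y; rewrite linearPr fl.
rewrite (@tensor_expand _ _ _ _ (fun s => g (u ⊗ₜ s))); last first.
  by move=> a x y; rewrite linearPr gl.
by apply: eq_tsum => v w.
Qed.

#[local] Arguments tassoc : simpl never.
#[local] Arguments tassocV : simpl never.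
#[local] Arguments tunitl : simpl never.
#[local] Arguments tunitr : simpl never.
#[local] Arguments tmul : simpl never.
#[local] Arguments tmap : simpl never.

(** * Whiskered maps on pure tensors *)

Section Whiskering.
Variables (K : fieldType) (U V U' V' : lmodType K).
Variable (f : {linear U ⊗ V -> U' ⊗ V'}).

Lemma tleftE (W : lmodType K) u v (w : W) :
  tleft W f (u ⊗ₜ (v ⊗ₜ w)) = \tsum_(p, q <- f (u ⊗ₜ v)) p ⊗ₜ (q ⊗ₜ w).
Proof.
rewrite /tleft /= tassocVE tmapE.
rewrite (@tensor_expand _ _ _ _ (fun t => tassoc (t ⊗ₜ idfun w))); last by lin.
by apply: eq_tsum => p q; rewrite tassocE.
Qed.

Lemma tmidE (X Y : lmodType K) (x : X) u v (y : Y) :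
  tmid X Y f ((x ⊗ₜ u) ⊗ₜ (v ⊗ₜ y)) =
  \tsum_(p, q <- f (u ⊗ₜ v)) (x ⊗ₜ p) ⊗ₜ (q ⊗ₜ y).
Proof.
rewrite /tmid /= tassocE tmapE tleftE /=.
rewrite (@tsum_push _ _ _ _ _ (fun t => tassocV (x ⊗ₜ t))); last by lin.
by apply: eq_tsum => p q; rewrite tassocVE.
Qed.
End Whiskering.

(** * The axioms in Sweedler notation *)

(** Here [g] is the context around the tensor to be opened: naming it selects the occurrence, and
    [lin] proves the context linear. *)
Ltac expand g := rewrite (@tensor_expand _ _ _ _ g); last by lin.

Section Sweedler.
Variables (K : fieldType) (W : lmodType K).

(** Currying: the sum over the last two factors is bilinear in [u] and the tensor [s], so the
    two-variable universal property applies again. *)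
Lemma trilin_tlift (U V X : lmodType K) (k : U -> V -> X -> W) : trilin k ->
  exists f : {linear U ⊗ (V ⊗ X) -> W},
    forall u v x, f (u ⊗ₜ (v ⊗ₜ x)) = k u v x.
Proof.
move=> [k1 k2 k3].
have kb u : bilin (k u) by split=> ?; auto.
have bk : bilin (fun u s => tsum s (k u)).
  by split=> [s|u]; [apply: lin_tsumr => v x; auto | apply: linear_tsum_l].
have [f [fE _]] := bilin_tlift bk.
by exists f => u v x; rewrite fE tsum_pure.
Qed.

Section Coalgebra.
Variables (A : lmodType K) (D : {linear A -> A ⊗ A}) (e : {linear A -> K^o}).

(** Once [k] is extended to a linear [f] on the triple tensor product, coassociativity is an
    equality between two arguments of [f]. The translations of the other multi-leg axioms follow the
    same pattern. *)
Lemma tsum_coassoc (DA : tassoc \o (D \ox @idfun A) \o D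
      =1 (@idfun A \ox D) \o D) x (k : A -> A -> A -> W) : trilin k ->
  \tsum_(u, v <- D x) \tsum_(p, q <- D u) k p q v =
  \tsum_(u, v <- D x) \tsum_(p, q <- D v) k u p q.
Proof.
move=> /trilin_tlift[f fE].
transitivity (f ((tassoc \o (D \ox @idfun A) \o D) x)); last first.
  rewrite DA /=; expand (fun t => f ((idfun \ox D) t)).
  apply: eq_tsum => u v; rewrite tmapE; expand (fun t => f (u ⊗ₜ t)).
  by apply: eq_tsum => p q; rewrite fE.
rewrite /=; expand (fun t => f (tassoc ((D \ox idfun) t))).
apply: eq_tsum => u v; rewrite tmapE; expand (fun t => f (tassoc (t ⊗ₜ idfun v))).
by apply: eq_tsum => p q; rewrite tassocE fE.
Qed.

Lemma tsum_counitl (De : tunitl \o (e \ox @idfun A) \o D =1 id)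
    x (k : A -> W) : linear k ->
  \tsum_(u, v <- D x) (e u : K) *: k v = k x.
Proof.
move=> kl; rewrite -[in RHS](De x) /=.
expand (fun t => k (tunitl ((e \ox idfun) t))).
by apply: eq_tsum => u v; rewrite tmapE tunitlE linear_scale.
Qed.

Lemma tsum_counitr (De : tunitr \o (@idfun A \ox e) \o D =1 id)
    x (k : A -> W) : linear k ->
  \tsum_(u, v <- D x) (e v : K) *: k u = k x.
Proof.
move=> kl; rewrite -[in RHS](De x) /=.
expand (fun t => k (tunitr ((idfun \ox e) t))).
by apply: eq_tsum => u v; rewrite tmapE tunitrE linear_scale.
Qed.
End Coalgebra.

Section Bialgebra.
Variables (A : algType K) (D : {linear A -> A ⊗ A}) (e : {linear A -> K^o}).
Variables (S : {linear A -> A}) (P : {linear A ⊗ A -> A ⊗ A}).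

Lemma tsum_coprodM (DM : D \o tmul =1 (tmul \ox tmul) \o tmid A A P \o (D \ox D))
    x y (k : A -> A -> W) : bilin k ->
  \tsum_(u, v <- D (x * y)) k u v =
  \tsum_(x1, x2 <- D x) \tsum_(y1, y2 <- D y) \tsum_(p, q <- P (x2 ⊗ₜ y1))
    k (x1 * p) (q * y2).
Proof.
move=> /bilin_tlift[f [fE fT]].
rewrite -fT -tmulE; have /= -> := DM (x ⊗ₜ y); rewrite tmapE.
expand (fun t => f ((tmul \ox tmul) (tmid A A P (t ⊗ₜ D y)))).
apply: eq_tsum => x1 x2.
expand (fun t => f ((tmul \ox tmul) (tmid A A P ((x1 ⊗ₜ x2) ⊗ₜ t)))).
apply: eq_tsum => y1 y2; rewrite tmidE !linear_tsum; apply: eq_tsum => p q.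
by rewrite tmapE !tmulE fE.
Qed.

Lemma tsum_antipodel
    (DS : forall x, (tmul \o (S \ox @idfun A) \o D) x = (e x : K)%:A)
    x (k : A -> W) : linear k ->
  \tsum_(u, v <- D x) k (S u * v) = (e x : K) *: k 1.
Proof.
move=> kl; rewrite -linear_scale // -DS /=.
expand (fun t => k (tmul ((S \ox idfun) t))).
by apply: eq_tsum => u v; rewrite tmapE tmulE.
Qed.

Lemma tsum_antipoder
    (DS : forall x, (tmul \o (@idfun A \ox S) \o D) x = (e x : K)%:A)
    x (k : A -> W) : linear k ->
  \tsum_(u, v <- D x) k (u * S v) = (e x : K) *: k 1.
Proof.
move=> kl; rewrite -linear_scale // -DS /=.
expand (fun t => k (tmul ((idfun \ox S) t))).
by apply: eq_tsum => u v; rewrite tmapE tmulE.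
Qed.
End Bialgebra.

Section Braiding.
Variables (H A : lmodType K) (Xi : {linear H ⊗ A -> A ⊗ H}).

(** After the coproduct, [h2] stands next to [a] and crosses it first; [h1] then meets the already
    transported [a']. This dictates the nesting of the inner sums. *)
Lemma tsum_braid_coprodl (D : {linear H -> H ⊗ H}) (XD : braid_coprodl Xi D)
    h a (k : A -> H -> H -> W) : trilin k ->
  \tsum_(a', h' <- Xi (h ⊗ₜ a)) \tsum_(p, q <- D h') k a' p q =
  \tsum_(h1, h2 <- D h) \tsum_(a', q <- Xi (h2 ⊗ₜ a))
    \tsum_(a'', p <- Xi (h1 ⊗ₜ a')) k a'' p q.
Proof.
move=> /trilin_tlift[f fE].
transitivity (f (((@idfun A \ox D) \o Xi) (h ⊗ₜ a))).
  rewrite /=; expand (fun t => f ((@idfun A \ox D) t)); apply: eq_tsum => a' h'.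
  rewrite tmapE; expand (fun t => f (a' ⊗ₜ t)).
  by apply: eq_tsum => p q; rewrite fE.
rewrite XD /comp tmapE.
expand (fun t => f (tleft H Xi ((idfun \ox Xi) (tassoc (t ⊗ₜ a))))).
apply: eq_tsum => h1 h2; rewrite tassocE tmapE.
expand (fun t => f (tleft H Xi (h1 ⊗ₜ t))).
apply: eq_tsum => a' q; rewrite tleftE linear_tsum.
by apply: eq_tsum => a'' p; rewrite fE.
Qed.

Lemma tsum_braid_coprodr (D : {linear A -> A ⊗ A}) (XD : braid_coprodr Xi D)
    h a (k : A -> A -> H -> W) : trilin k ->
  \tsum_(a', h' <- Xi (h ⊗ₜ a)) \tsum_(p, q <- D a') k p q h' =
  \tsum_(a1, a2 <- D a) \tsum_(p, h' <- Xi (h ⊗ₜ a1))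
    \tsum_(q, h'' <- Xi (h' ⊗ₜ a2)) k p q h''.
Proof.
move=> /trilin_tlift[f fE].
transitivity (f ((tassoc \o (D \ox @idfun H) \o Xi) (h ⊗ₜ a))).
  rewrite /=; expand (fun t => f (tassoc ((D \ox @idfun H) t))).
  apply: eq_tsum => a' h'; rewrite tmapE.
  expand (fun t => f (tassoc (t ⊗ₜ idfun h'))).
  by apply: eq_tsum => p q; rewrite tassocE fE.
rewrite XD /comp tmapE.
expand (fun t => f ((idfun \ox Xi) (tleft A Xi (h ⊗ₜ t)))).
apply: eq_tsum => a1 a2; rewrite tleftE !linear_tsum.
apply: eq_tsum => p h'; rewrite tmapE; expand (fun t => f (p ⊗ₜ t)).
by apply: eq_tsum => q h''; rewrite fE.
Qed.
End Braiding.

Lemma tsum_braid_mull (H : algType K) (A : lmodType K)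
    (Xi : {linear H ⊗ A -> A ⊗ H}) (XM : braid_mull Xi tmul)
    h g a (k : A -> H -> W) : bilin k ->
  \tsum_(p, q <- Xi ((h * g) ⊗ₜ a)) k p q =
  \tsum_(a', g' <- Xi (g ⊗ₜ a)) \tsum_(a'', h' <- Xi (h ⊗ₜ a'))
    k a'' (h' * g').
Proof.
move=> /bilin_tlift[f [fE fT]].
have := XM (h ⊗ₜ (g ⊗ₜ a)); rewrite /comp tassocVE !tmapE tmulE -fT => ->.
expand (fun t => f ((idfun \ox tmul) (tleft H Xi (h ⊗ₜ t)))).
apply: eq_tsum => a' g'; rewrite tleftE !linear_tsum.
by apply: eq_tsum => a'' h'; rewrite tmapE tmulE fE.
Qed.

Lemma tsum_braid_mulr (H : lmodType K) (A : algType K)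
    (Xi : {linear H ⊗ A -> A ⊗ H}) (XM : braid_mulr Xi tmul)
    h a b (k : A -> H -> W) : bilin k ->
  \tsum_(p, q <- Xi (h ⊗ₜ (a * b))) k p q =
  \tsum_(a', h' <- Xi (h ⊗ₜ a)) \tsum_(b', h'' <- Xi (h' ⊗ₜ b))
    k (a' * b') h''.
Proof.
move=> /bilin_tlift[f [fE fT]].
have := XM (h ⊗ₜ (a ⊗ₜ b)); rewrite /comp tmapE tmulE -fT => ->.
rewrite tleftE !linear_tsum; apply: eq_tsum => a' h'; rewrite tmapE.
expand (fun t => f ((tmul \ox idfun) (tassocV (a' ⊗ₜ t)))).
by apply: eq_tsum => b' h''; rewrite tassocVE tmapE tmulE fE.
Qed.
End Sweedler.

(** * Sweedler calculus in one braided Hopf algebra, and recovery of its braiding *)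

Section BraidedHopfSweedler.
Variables (K : fieldType) (A : braidedHopfType K) (W : lmodType K).

Lemma hopf_coprodA (x : A) (k : A -> A -> A -> W) : trilin k ->
  \tsum_(u, v <- coprod x) \tsum_(p, q <- coprod u) k p q v =
  \tsum_(u, v <- coprod x) \tsum_(p, q <- coprod v) k u p q.
Proof. exact/tsum_coassoc/coprodA. Qed.

Lemma hopf_counitl (x : A) (k : A -> W) : linear k ->
  \tsum_(u, v <- coprod x) (counit u : K) *: k v = k x.
Proof. exact/tsum_counitl/counitl. Qed.

Lemma hopf_counitr (x : A) (k : A -> W) : linear k ->
  \tsum_(u, v <- coprod x) (counit v : K) *: k u = k x.
Proof. exact/tsum_counitr/counitr. Qed.

Lemma hopf_antipodel (x : A) (k : A -> W) : linear k ->
  \tsum_(u, v <- coprod x) k (antipode u * v) = (counit x : K) *: k 1.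
Proof. exact/tsum_antipodel/antipodel. Qed.

Lemma hopf_antipoder (x : A) (k : A -> W) : linear k ->
  \tsum_(u, v <- coprod x) k (u * antipode v) = (counit x : K) *: k 1.
Proof. exact/tsum_antipoder/antipoder. Qed.

(* Cancelling a_1 and b_2 in coprod (a * b) = a_1 Psi(a_2 ⊗ b_1) b_2 shows that
   the braiding is determined by the product, coproduct and antipode. *)
Lemma hopf_braid (x y : A) (k : A -> A -> W) : bilin k ->
  \tsum_(p, q <- braid (x ⊗ₜ y)) k p q =
  \tsum_(x1, x2 <- coprod x) \tsum_(y1, y2 <- coprod y)
    \tsum_(u, v <- coprod (x2 * y1)) k (antipode x1 * u) (v * antipode y2).
Proof.
move=> [k1 k2]; symmetry.
transitivity (\tsum_(x1, x2 <- coprod x) \tsum_(s, t <- coprod x2)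
   \tsum_(y1, y2 <- coprod y) \tsum_(z, w <- coprod y1)
   \tsum_(p, q <- braid (t ⊗ₜ z))
    k (antipode x1 * s * p) (q * (w * antipode y2))).
  apply: eq_tsum => x1 x2; rewrite exchange_tsum; apply: eq_tsum => y1 y2.
  rewrite (tsum_coprodM (@coprodM _ _)); last by lin.
  apply: eq_tsum => s t; apply: eq_tsum => z w; apply: eq_tsum => p q.
  by rewrite !mulrA.
rewrite -(hopf_coprodA _ (k := fun x1 s t => \tsum_(y1, y2 <- coprod y) 
   \tsum_(z, w <- coprod y1) \tsum_(p, q <- braid (t ⊗ₜ z))
    k (antipode x1 * s * p) (q * (w * antipode y2)))); last by lin.
under eq_tsum => x1 x2 do [rewrite (hopf_antipodel _ (k := fun s =>
   \tsum_(y1, y2 <- coprod y) \tsum_(z, w <- coprod y1)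
   \tsum_(p, q <- braid (x2 ⊗ₜ z)) k (s * p) (q * (w * antipode y2)))); last by lin].
rewrite (hopf_counitl _ (k := fun t => \tsum_(y1, y2 <- coprod y)
   \tsum_(z, w <- coprod y1) \tsum_(p, q <- braid (t ⊗ₜ z))
    k (1 * p) (q * (w * antipode y2)))); last by lin.
rewrite (hopf_coprodA _ (k := fun z w v => \tsum_(p, q <- braid (x ⊗ₜ z))
    k (1 * p) (q * (w * antipode v)))); last by lin.
under eq_tsum => y1 y2 do [rewrite (hopf_antipoder _ (k := fun r =>
   \tsum_(p, q <- braid (x ⊗ₜ y1)) k (1 * p) (q * r))); last by lin].
rewrite (hopf_counitr _ (k := fun r => \tsum_(p, q <- braid (x ⊗ₜ r))
   k (1 * p) (q * 1))); last by lin.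
by apply: eq_tsum => p q; rewrite mul1r mulr1.
Qed.
End BraidedHopfSweedler.
(** * Braidings between two braided Hopf algebras *)

Section MutualBraiding.
Variables (K : fieldType) (H A : braidedHopfType K).
Variables (Xi : {linear H ⊗ A -> A ⊗ H}) (XiP : mutual_braiding Xi).

(** Surjectivity of [Xi] allows linear maps to be tested on crossed tensors, where the compatibility
    axioms speak. *)
Lemma mutual_onto (W : lmodType K) (f g : A ⊗ H -> W) :
  linear f -> linear g ->
  (forall h a, f (Xi (h ⊗ₜ a)) = g (Xi (h ⊗ₜ a))) -> f =1 g.
Proof.
move=> fl gl fg t; have [Xi' _ XiK] := mutual_bij XiP.
rewrite -[t]XiK; expand (fun s => f (Xi s)); expand (fun s => g (Xi s)).
exact: eq_tsum.
Qed.

Section Sweedler.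
Variable W : lmodType K.

Lemma mutual_mullE h g a (k : A -> H -> W) : bilin k ->
  \tsum_(p, q <- Xi ((h * g) ⊗ₜ a)) k p q =
  \tsum_(a', g' <- Xi (g ⊗ₜ a)) \tsum_(a'', h' <- Xi (h ⊗ₜ a'))
    k a'' (h' * g').
Proof. exact/tsum_braid_mull/(mutual_mull XiP). Qed.

Lemma mutual_mulrE h a b (k : A -> H -> W) : bilin k ->
  \tsum_(p, q <- Xi (h ⊗ₜ (a * b))) k p q =
  \tsum_(a', h' <- Xi (h ⊗ₜ a)) \tsum_(b', h'' <- Xi (h' ⊗ₜ b))
    k (a' * b') h''.
Proof. exact/tsum_braid_mulr/(mutual_mulr XiP). Qed.

Lemma mutual_coprodlE h a (k : A -> H -> H -> W) : trilin k ->
  \tsum_(a', h' <- Xi (h ⊗ₜ a)) \tsum_(p, q <- coprod h') k a' p q =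
  \tsum_(h1, h2 <- coprod h) \tsum_(a', q <- Xi (h2 ⊗ₜ a))
    \tsum_(a'', p <- Xi (h1 ⊗ₜ a')) k a'' p q.
Proof. exact/tsum_braid_coprodl/(mutual_coprodl XiP). Qed.

Lemma mutual_coprodrE h a (k : A -> A -> H -> W) : trilin k ->
  \tsum_(a', h' <- Xi (h ⊗ₜ a)) \tsum_(p, q <- coprod a') k p q h' =
  \tsum_(a1, a2 <- coprod a) \tsum_(p, h' <- Xi (h ⊗ₜ a1))
    \tsum_(q, h'' <- Xi (h' ⊗ₜ a2)) k p q h''.
Proof. exact/tsum_braid_coprodr/(mutual_coprodr XiP). Qed.
End Sweedler.

(** The map sending [a' ⊗ₜ g'] to [Xi (1 ⊗ₜ a')] multiplied on the right by [g'] fixes every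
    [Xi (h ⊗ₜ b)], because [1 * h = h]. By surjectivity it is the identity, and its value at
    [a ⊗ₜ 1] gives the claim. *)
Lemma mutual1l a : Xi (1 ⊗ₜ a) = a ⊗ₜ 1.
Proof.
pose k (a' : A) (g' : H) := \tsum_(a'', h' <- Xi (1 ⊗ₜ a')) a'' ⊗ₜ (h' * g').
have kb : bilin k by rewrite /k; lin.
have kid : (fun t => tsum t k) =1 idfun.
  apply: mutual_onto => [||h b]; [lin | by [] | ].
  rewrite /k -(mutual_mullE _ _ _ (k := fun a g => a ⊗ₜ g)); last by lin.
  by rewrite mul1r -tensorE.
rewrite -[RHS](kid (a ⊗ₜ 1)) tsum_pure // [LHS]tensorE.
by apply: eq_tsum => p q; rewrite mulr1.
Qed.

Lemma mutual1r h : Xi (h ⊗ₜ 1) = 1 ⊗ₜ h.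
Proof.
pose k (a' : A) (h' : H) := \tsum_(b', h'' <- Xi (h' ⊗ₜ 1)) (a' * b') ⊗ₜ h''.
have kb : bilin k by rewrite /k; lin.
have kid : (fun t => tsum t k) =1 idfun.
  apply: mutual_onto => [||g b]; [lin | by [] | ].
  rewrite /k -(mutual_mulrE _ _ _ (k := fun a g => a ⊗ₜ g)); last by lin.
  by rewrite mulr1 -tensorE.
rewrite -[RHS](kid (1 ⊗ₜ h)) tsum_pure // [LHS]tensorE.
by apply: eq_tsum => p q; rewrite mul1r.
Qed.

(** Applying [Xi] to the right side of [key] and using the coproduct axiom and the counit gives
    [Xi (h ⊗ₜ a)], so [key] holds by injectivity of [Xi]. Applying the counit to the first leg of
    [key] and [k] to the second then yields the claim. *)
Lemma mutual_counitl (W : lmodType K) h a (k : A -> W) : linear k ->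
  \tsum_(a', h' <- Xi (h ⊗ₜ a)) (counit h' : K) *: k a' = (counit h : K) *: k a.
Proof.
move=> kl.
have key : h ⊗ₜ a = \tsum_(h1, h2 <- coprod h) \tsum_(a', q <- Xi (h2 ⊗ₜ a))
    (counit q : K) *: (h1 ⊗ₜ a').
  apply: (bij_inj (mutual_bij XiP)).
  transitivity (\tsum_(a', h' <- Xi (h ⊗ₜ a)) \tsum_(p, q <- coprod h')
      (counit q : K) *: (a' ⊗ₜ p)).
    by rewrite [LHS]tensorE; apply: eq_tsum => a' h'; rewrite hopf_counitr //; lin.
  rewrite (mutual_coprodlE _ _ (k := fun a' p q => (counit q : K) *: (a' ⊗ₜ p)));
    last by lin.
  rewrite linear_tsum; apply: eq_tsum => h1 h2.
  rewrite linear_tsum; apply: eq_tsum => a' q.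
  by rewrite -tsumZ -tensorE linearZ.
transitivity (tsum (h ⊗ₜ a) (fun h a => (counit h : K) *: k a)); last first.
  by rewrite tsum_pure //; lin.
rewrite [in RHS]key tsum_tsum; last by lin.
rewrite -[LHS](hopf_counitl h (k := fun h =>
  \tsum_(a', h' <- Xi (h ⊗ₜ a)) (counit h' : K) *: k a')); last by lin.
apply: eq_tsum => h1 h2; rewrite tsum_tsum; last by lin.
rewrite tsumZ; apply: eq_tsum => a' q.
rewrite tsum_scale; last by lin.
by rewrite tsum_pure ?scalerA ?[_ * counit q]mulrC //; lin.
Qed.

Lemma mutual_counitr (W : lmodType K) h a (k : H -> W) : linear k ->
  \tsum_(a', h' <- Xi (h ⊗ₜ a)) (counit a' : K) *: k h' = (counit a : K) *: k h.
Proof.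
move=> kl.
have key : h ⊗ₜ a = \tsum_(a1, a2 <- coprod a) \tsum_(p, h' <- Xi (h ⊗ₜ a1))
    (counit p : K) *: (h' ⊗ₜ a2).
  apply: (bij_inj (mutual_bij XiP)).
  transitivity (\tsum_(a', h' <- Xi (h ⊗ₜ a)) \tsum_(p, q <- coprod a')
      (counit p : K) *: (q ⊗ₜ h')).
    rewrite [LHS]tensorE; apply: eq_tsum => a' h'.
    by rewrite (hopf_counitl _ (k := fun q => q ⊗ₜ h')) //; lin.
  rewrite (mutual_coprodrE _ _ (k := fun p q h' => (counit p : K) *: (q ⊗ₜ h')));
    last by lin.
  rewrite linear_tsum; apply: eq_tsum => a1 a2.
  rewrite linear_tsum; apply: eq_tsum => p h'.
  by rewrite -tsumZ -tensorE linearZ.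
transitivity (tsum (h ⊗ₜ a) (fun h a => (counit a : K) *: k h)); last first.
  by rewrite tsum_pure //; lin.
rewrite [in RHS]key tsum_tsum; last by lin.
rewrite -[LHS](hopf_counitr a (k := fun a =>
  \tsum_(a', h' <- Xi (h ⊗ₜ a)) (counit a' : K) *: k h')); last by lin.
apply: eq_tsum => a1 a2; rewrite tsum_tsum; last by lin.
rewrite tsumZ; apply: eq_tsum => p h'.
rewrite tsum_scale; last by lin.
by rewrite tsum_pure ?scalerA ?[_ * counit p]mulrC //; lin.
Qed.

(* The left side is a right inverse and the right side a left inverse of Xi for
   the convolution product. *)
Lemma mutual_antipoder h a :
  Xi (h ⊗ₜ antipode a) = \tsum_(p, q <- Xi (h ⊗ₜ a)) antipode p ⊗ₜ q.
Proof.
transitivity (\tsum_(a1, a2 <- coprod a) \tsum_(x, y <- coprod a1)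
  \tsum_(p, h1 <- Xi (h ⊗ₜ x)) \tsum_(q, h2 <- Xi (h1 ⊗ₜ y))
  \tsum_(r, h3 <- Xi (h2 ⊗ₜ antipode a2)) (antipode p * (q * r)) ⊗ₜ h3).
  rewrite -[LHS](hopf_counitl a (k := fun a => Xi (h ⊗ₜ antipode a))); last by lin.
  apply: eq_tsum => a1 a2.
  rewrite -(mutual_coprodrE _ _ (k := fun p q h2 =>
    \tsum_(r, h3 <- Xi (h2 ⊗ₜ antipode a2)) (antipode p * (q * r)) ⊗ₜ h3));
    last by lin.
  rewrite -(mutual_counitr _ _ (k := fun h2 => Xi (h2 ⊗ₜ antipode a2))); last by lin.
  apply: eq_tsum => z h2.
  transitivity ((counit z : K) *: \tsum_(r, h3 <- Xi (h2 ⊗ₜ antipode a2))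
      (1 * r) ⊗ₜ h3).
    by congr (_ *: _); rewrite [LHS]tensorE; apply: eq_tsum => r h3; rewrite mul1r.
  rewrite -(hopf_antipodel z (k := fun s =>
    \tsum_(r, h3 <- Xi (h2 ⊗ₜ antipode a2)) (s * r) ⊗ₜ h3)); last by lin.
  apply: eq_tsum => p q; apply: eq_tsum => r h3.
  by rewrite mulrA.
rewrite (hopf_coprodA _ (k := fun x y a2 => \tsum_(p, h1 <- Xi (h ⊗ₜ x))
  \tsum_(q, h2 <- Xi (h1 ⊗ₜ y)) \tsum_(r, h3 <- Xi (h2 ⊗ₜ antipode a2))
  (antipode p * (q * r)) ⊗ₜ h3)); last by lin.
rewrite -[RHS](hopf_counitr a (k := fun a => \tsum_(p, q <- Xi (h ⊗ₜ a))
  antipode p ⊗ₜ q)); last by lin.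
apply: eq_tsum => a1 a2; rewrite exchange_tsum tsumZ.
apply: eq_tsum => p h1.
under eq_tsum => x y do [rewrite -(mutual_mulrE _ _ _ (k := fun s h3 =>
  (antipode p * s) ⊗ₜ h3)); last by lin].
rewrite (hopf_antipoder _ (k := fun z => \tsum_(s, h3 <- Xi (h1 ⊗ₜ z))
  (antipode p * s) ⊗ₜ h3)); last by lin.
by rewrite mutual1r tsum_pure ?mulr1 //; lin.
Qed.

(** Mirror image of the previous argument, convolving over the coproduct of [h]. The roles are
    exchanged: the left side is now the left inverse of [Xi], and the right side the right
    inverse. *)
Lemma mutual_antipodel h a :
  Xi (antipode h ⊗ₜ a) = \tsum_(p, q <- Xi (h ⊗ₜ a)) p ⊗ₜ antipode q.
Proof.
transitivity (\tsum_(h1, h2 <- coprod h) \tsum_(x, y <- coprod h2)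
  \tsum_(a1, r <- Xi (y ⊗ₜ a)) \tsum_(a2, q <- Xi (x ⊗ₜ a1))
  \tsum_(a3, p <- Xi (antipode h1 ⊗ₜ a2)) a3 ⊗ₜ ((p * q) * antipode r)).
  rewrite -[LHS](hopf_counitr h (k := fun h => Xi (antipode h ⊗ₜ a))); last by lin.
  apply: eq_tsum => h1 h2.
  rewrite -(mutual_coprodlE _ _ (k := fun a2 q r =>
    \tsum_(a3, p <- Xi (antipode h1 ⊗ₜ a2)) a3 ⊗ₜ ((p * q) * antipode r)));
    last by lin.
  rewrite -(mutual_counitl _ _ (k := fun a2 => Xi (antipode h1 ⊗ₜ a2))); last by lin.
  apply: eq_tsum => a2 z.
  (* The factor 1 is inserted so that the antipode law can be read backwards, replacing [counit z]
     by a product [q * antipode r]. *)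
  transitivity ((counit z : K) *: \tsum_(a3, p <- Xi (antipode h1 ⊗ₜ a2))
      a3 ⊗ₜ (p * 1)).
    by congr (_ *: _); rewrite [LHS]tensorE; apply: eq_tsum => a3 p; rewrite mulr1.
  rewrite -(hopf_antipoder z (k := fun s =>
    \tsum_(a3, p <- Xi (antipode h1 ⊗ₜ a2)) a3 ⊗ₜ (p * s))); last by lin.
  apply: eq_tsum => q r; apply: eq_tsum => a3 p.
  by rewrite mulrA.
rewrite -(hopf_coprodA _ (k := fun h1 x y => \tsum_(a1, r <- Xi (y ⊗ₜ a))
  \tsum_(a2, q <- Xi (x ⊗ₜ a1)) \tsum_(a3, p <- Xi (antipode h1 ⊗ₜ a2))
  a3 ⊗ₜ ((p * q) * antipode r))); last by lin.
rewrite -[RHS](hopf_counitl h (k := fun h => \tsum_(p, q <- Xi (h ⊗ₜ a))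
  p ⊗ₜ antipode q)); last by lin.
apply: eq_tsum => h1 h2; rewrite exchange_tsum tsumZ.
apply: eq_tsum => a1 r.
under eq_tsum => x y do [rewrite -(mutual_mullE _ _ _ (k := fun a3 s =>
  a3 ⊗ₜ (s * antipode r))); last by lin].
rewrite (hopf_antipodel _ (k := fun z => \tsum_(a3, s <- Xi (z ⊗ₜ a1))
  a3 ⊗ₜ (s * antipode r))); last by lin.
by rewrite mutual1l tsum_pure ?mul1r //; lin.
Qed.
End MutualBraiding.

(** * The mixed Yang-Baxter equations *)

Section MixedYangBaxter.
Variables (K : fieldType) (H A : braidedHopfType K) (W : lmodType K).
Variables (Xi : {linear H ⊗ A -> A ⊗ H}) (XiP : mutual_braiding Xi).

Lemma mutual_antipoderE h a (k : A -> H -> W) : bilin k ->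
  \tsum_(p, q <- Xi (h ⊗ₜ antipode a)) k p q =
  \tsum_(p, q <- Xi (h ⊗ₜ a)) k (antipode p) q.
Proof.
move=> kb; rewrite (mutual_antipoder XiP) tsum_tsum //.
by apply: eq_tsum => p q; rewrite tsum_pure.
Qed.

Lemma mutual_antipodelE h a (k : A -> H -> W) : bilin k ->
  \tsum_(p, q <- Xi (antipode h ⊗ₜ a)) k p q =
  \tsum_(p, q <- Xi (h ⊗ₜ a)) k p (antipode q).
Proof.
move=> kb; rewrite (mutual_antipodel XiP) tsum_tsum //.
by apply: eq_tsum => p q; rewrite tsum_pure.
Qed.

(** By [hopf_braid] the braiding of [A] is composed of products, coproducts and antipodes, and the
    strand [h] passes through each of these. *)
Lemma mutual_yang_baxterr h x y (k : A -> A -> H -> W) : trilin k ->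
  \tsum_(p, q <- braid (x ⊗ₜ y)) \tsum_(p', h' <- Xi (h ⊗ₜ p))
    \tsum_(q', h'' <- Xi (h' ⊗ₜ q)) k p' q' h'' =
  \tsum_(x', h' <- Xi (h ⊗ₜ x)) \tsum_(y', h'' <- Xi (h' ⊗ₜ y))
    \tsum_(p, q <- braid (x' ⊗ₜ y')) k p q h''.
Proof.
move=> [k1 k2 k3].
(* Common form of both sides: the strand [h] has crossed the four legs [x1], [x2], [y1], [y2] one
   after another, and the coproduct of the middle product is taken only afterwards. *)
transitivity (\tsum_(x1, x2 <- coprod x) \tsum_(s, h1 <- Xi (h ⊗ₜ x1))
  \tsum_(t, h2 <- Xi (h1 ⊗ₜ x2)) \tsum_(y1, y2 <- coprod y)
  \tsum_(w, h3 <- Xi (h2 ⊗ₜ y1)) \tsum_(r, h4 <- Xi (h3 ⊗ₜ y2))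
  \tsum_(u, v <- coprod (t * w)) k (antipode s * u) (v * antipode r) h4).
  rewrite hopf_braid; last by lin.
  apply: eq_tsum => x1 x2.
  under [RHS]eq_tsum => s h1 do rewrite exchange_tsum.
  rewrite [RHS]exchange_tsum; apply: eq_tsum => y1 y2.
  transitivity (\tsum_(u, v <- coprod (x2 * y1)) \tsum_(s, h1 <- Xi (h ⊗ₜ x1))
    \tsum_(u', h2 <- Xi (h1 ⊗ₜ u)) \tsum_(v', h3 <- Xi (h2 ⊗ₜ v))
    \tsum_(r, h4 <- Xi (h3 ⊗ₜ y2)) k (antipode s * u') (v' * antipode r) h4).
    apply: eq_tsum => u v; rewrite (mutual_mulrE XiP); last by lin.
    rewrite mutual_antipoderE; last by lin.
    apply: eq_tsum => s h1; apply: eq_tsum => u' h2.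
    rewrite (mutual_mulrE XiP); last by lin.
    by apply: eq_tsum => v' h3; rewrite mutual_antipoderE; last by lin.
  rewrite exchange_tsum; apply: eq_tsum => s h1.
  rewrite -(mutual_coprodrE XiP _ _ (k := fun u v h3 =>
    \tsum_(r, h4 <- Xi (h3 ⊗ₜ y2)) k (antipode s * u) (v * antipode r) h4));
    last by lin.
  rewrite (mutual_mulrE XiP); last by lin.
  by do 2 (apply: eq_tsum => ? ?); rewrite exchange_tsum.
transitivity (\tsum_(x', h' <- Xi (h ⊗ₜ x)) \tsum_(x1, x2 <- coprod x')
  \tsum_(y', h'' <- Xi (h' ⊗ₜ y)) \tsum_(y1, y2 <- coprod y')
  \tsum_(u, v <- coprod (x2 * y1)) k (antipode x1 * u) (v * antipode y2) h'').
  rewrite (mutual_coprodrE XiP _ _ (k := fun x1 x2 h' =>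
    \tsum_(y', h'' <- Xi (h' ⊗ₜ y)) \tsum_(y1, y2 <- coprod y')
    \tsum_(u, v <- coprod (x2 * y1))
    k (antipode x1 * u) (v * antipode y2) h'')); last by lin.
  do 3 (apply: eq_tsum => ? ?).
  rewrite (mutual_coprodrE XiP _ _ (k := fun y1 y2 h'' =>
    \tsum_(u, v <- coprod (_ * y1))
    k (antipode _ * u) (v * antipode y2) h'')) //; lin.
apply: eq_tsum => x' h'; rewrite exchange_tsum; apply: eq_tsum => y' h''.
by rewrite hopf_braid; last by lin.
Qed.

(** The same scheme with [hopf_braid] applied in [H]. The strand [a] now moves leftwards, so it
    meets the legs in the order [g2], [g1], [h2], [h1]. *)
Lemma mutual_yang_baxterl h g a (k : A -> H -> H -> W) : trilin k ->
  \tsum_(p, q <- braid (h ⊗ₜ g)) \tsum_(a', q' <- Xi (q ⊗ₜ a))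
    \tsum_(a'', p' <- Xi (p ⊗ₜ a')) k a'' p' q' =
  \tsum_(a', g' <- Xi (g ⊗ₜ a)) \tsum_(a'', h' <- Xi (h ⊗ₜ a'))
    \tsum_(p, q <- braid (h' ⊗ₜ g')) k a'' p q.
Proof.
move=> [k1 k2 k3].
transitivity (\tsum_(h1, h2 <- coprod h) \tsum_(g1, g2 <- coprod g)
  \tsum_(a1, r <- Xi (g2 ⊗ₜ a)) \tsum_(a2, w <- Xi (g1 ⊗ₜ a1))
  \tsum_(a3, t <- Xi (h2 ⊗ₜ a2)) \tsum_(a4, s <- Xi (h1 ⊗ₜ a3))
  \tsum_(u, v <- coprod (t * w)) k a4 (antipode s * u) (v * antipode r)).
  rewrite hopf_braid; last by lin.
  apply: eq_tsum => h1 h2; apply: eq_tsum => g1 g2.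
  transitivity (\tsum_(u, v <- coprod (h2 * g1)) \tsum_(a1, r <- Xi (g2 ⊗ₜ a))
    \tsum_(a2, v' <- Xi (v ⊗ₜ a1)) \tsum_(a3, u' <- Xi (u ⊗ₜ a2))
    \tsum_(a4, s <- Xi (h1 ⊗ₜ a3)) k a4 (antipode s * u') (v' * antipode r)).
    apply: eq_tsum => u v; rewrite (mutual_mullE XiP); last by lin.
    rewrite mutual_antipodelE; last by lin.
    apply: eq_tsum => a1 r; apply: eq_tsum => a2 v'.
    rewrite (mutual_mullE XiP); last by lin.
    by apply: eq_tsum => a3 u'; rewrite mutual_antipodelE; last by lin.
  rewrite exchange_tsum; apply: eq_tsum => a1 r.
  rewrite -(mutual_coprodlE XiP _ _ (k := fun a3 u v =>
    \tsum_(a4, s <- Xi (h1 ⊗ₜ a3)) k a4 (antipode s * u) (v * antipode r)));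
    last by lin.
  rewrite (mutual_mullE XiP); last by lin.
  by do 2 (apply: eq_tsum => ? ?); rewrite exchange_tsum.
transitivity (\tsum_(a', g' <- Xi (g ⊗ₜ a)) \tsum_(h1, h2 <- coprod h)
  \tsum_(y1, y2 <- coprod g') \tsum_(a3, t <- Xi (h2 ⊗ₜ a'))
  \tsum_(a4, s <- Xi (h1 ⊗ₜ a3)) \tsum_(u, v <- coprod (t * y1))
  k a4 (antipode s * u) (v * antipode y2)).
  rewrite [RHS]exchange_tsum; apply: eq_tsum => h1 h2.
  rewrite (mutual_coprodlE XiP _ _ (k := fun a' y1 y2 =>
    \tsum_(a3, t <- Xi (h2 ⊗ₜ a')) \tsum_(a4, s <- Xi (h1 ⊗ₜ a3))
    \tsum_(u, v <- coprod (t * y1))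
    k a4 (antipode s * u) (v * antipode y2))) //; lin.
apply: eq_tsum => a' g'.
transitivity (\tsum_(a'', h' <- Xi (h ⊗ₜ a')) \tsum_(x1, x2 <- coprod h')
  \tsum_(y1, y2 <- coprod g') \tsum_(u, v <- coprod (x2 * y1))
  k a'' (antipode x1 * u) (v * antipode y2)); last first.
  by apply: eq_tsum => a'' h'; rewrite hopf_braid; last by lin.
rewrite (mutual_coprodlE XiP _ _ (k := fun a'' x1 x2 =>
  \tsum_(y1, y2 <- coprod g') \tsum_(u, v <- coprod (x2 * y1))
  k a'' (antipode x1 * u) (v * antipode y2))); last by lin.
apply: eq_tsum => h1 h2; rewrite exchange_tsum; apply: eq_tsum => a3 t.
by rewrite exchange_tsum.
Qed.
End MixedYangBaxter.
(** * The action defined by a braided pairing *)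

(** An algebra map [e] has the convolution inverse [e] composed with the antipode, so cancelling one
    factor in the idempotency of [e] leaves the counit. The proof evaluates the triple convolution
    of [e], [e] and this inverse in both bracketings. *)
Lemma idem_alg_form_counit (K : fieldType) (A : braidedHopfType K)
    (e : {linear A -> K^o}) :
  e 1 = 1 -> (forall a b, e (a * b) = (e a : K) *: e b) ->
  (forall a, \tsum_(a1, a2 <- coprod a) (e a1 : K) *: e a2 = e a) ->
  forall a, e a = counit a.
Proof.
move=> e1 eM eI a.
transitivity (\tsum_(a1, a2 <- coprod a) \tsum_(x, y <- coprod a2)
  (e a1 : K) *: ((e x : K) *: e (antipode y))).
  rewrite -[LHS](hopf_counitr a (k := e)); last by lin.
  apply: eq_tsum => a1 a2.
  rewrite -tsumZ; under eq_tsum => x y do rewrite -eM.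
  rewrite (hopf_antipoder _ (k := e)); last by lin.
  rewrite e1 [RHS]scalerA mulrC -scalerA; congr (_ *: _).
  by rewrite [RHS]mulr1.
rewrite -(hopf_coprodA _ (k := fun x y z =>
  (e x : K) *: ((e y : K) *: e (antipode z)))); last by lin.
transitivity (\tsum_(a1, a2 <- coprod a) e (a1 * antipode a2)).
  apply: eq_tsum => a1 a2; rewrite eM -[in RHS]eI.
  rewrite (@tsum_push _ _ _ _ _ (fun z : K^o => (z : K) *: e (antipode a2)));
    last by lin.
  by apply: eq_tsum => x y; rewrite scalerA.
rewrite (hopf_antipoder _ (k := e)); last by lin.
by rewrite e1 [LHS]mulr1.
Qed.

Section PairingAction.
Variables (K : fieldType) (H A : braidedHopfType K).
Variables (Xi : {linear H ⊗ A -> A ⊗ H}) (pr : {linear H ⊗ A -> K^o}).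
Hypothesis XiP : mutual_braiding Xi.
Hypothesis prP : braided_pairing Xi pr.
Hypothesis pr_neq0 : exists t : H ⊗ A, pr t != 0.
Hypothesis pr_braidA :
  tunitr \o (@idfun A \ox pr) \o tleft A Xi \o (@idfun H \ox braid)
    =1 tunitl \o (pr \ox @idfun A) \o tassocV.
Hypothesis pr_braidH :
  tunitl \o (pr \ox @idfun H) \o tassocV \o (@idfun H \ox Xi)
      \o tleft A braid
    =1 tunitr \o (@idfun H \ox pr).

Lemma pairing_mulrE h a b :
  pr (h ⊗ₜ (a * b)) = \tsum_(h1, h2 <- coprod h)
    \tsum_(a', h' <- Xi (h2 ⊗ₜ a)) (pr (h1 ⊗ₜ a') : K) *: pr (h' ⊗ₜ b).
Proof.
have := pairing_mulr prP (h ⊗ₜ (a ⊗ₜ b)); rewrite /comp !tmapE tmulE => ->.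
expand (fun t => tunitl ((pr \ox pr) (tmid H A Xi (t ⊗ₜ (a ⊗ₜ b))))).
apply: eq_tsum => h1 h2; rewrite tmidE !linear_tsum.
by apply: eq_tsum => a' h'; rewrite tmapE tunitlE.
Qed.

Lemma pairing_mullE h g a :
  pr ((h * g) ⊗ₜ a) = \tsum_(a1, a2 <- coprod a)
    \tsum_(a', g' <- Xi (g ⊗ₜ a1)) (pr (h ⊗ₜ a') : K) *: pr (g' ⊗ₜ a2).
Proof.
have := pairing_mull prP ((h ⊗ₜ g) ⊗ₜ a); rewrite /comp !tmapE tmulE => ->.
expand (fun t => tunitl ((pr \ox pr) (tmid H A Xi ((h ⊗ₜ g) ⊗ₜ t)))).
apply: eq_tsum => a1 a2; rewrite tmidE !linear_tsum.
by apply: eq_tsum => a' g'; rewrite tmapE tunitlE.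
Qed.

Lemma pairing_braidA h a b (W : lmodType K) (k : A -> W) : linear k ->
  \tsum_(p, q <- braid (a ⊗ₜ b)) \tsum_(p', h' <- Xi (h ⊗ₜ p))
    (pr (h' ⊗ₜ q) : K) *: k p' = (pr (h ⊗ₜ a) : K) *: k b.
Proof.
move=> kl; rewrite -linear_scale //.
have := pr_braidA (h ⊗ₜ (a ⊗ₜ b)); rewrite /comp tassocVE !tmapE tunitlE => <-.
expand (fun t => k (tunitr ((idfun \ox pr) (tleft A Xi (h ⊗ₜ t))))).
apply: eq_tsum => p q; rewrite tleftE.
rewrite (@tsum_push _ _ _ _ _ (fun t => k (tunitr ((idfun \ox pr) t))));
  last by lin.
by apply: eq_tsum => p' h'; rewrite tmapE tunitrE linear_scale.
Qed.

Lemma pairing_braidH h g a (W : lmodType K) (k : H -> W) : linear k ->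
  \tsum_(p, q <- braid (h ⊗ₜ g)) \tsum_(a', q' <- Xi (q ⊗ₜ a))
    (pr (p ⊗ₜ a') : K) *: k q' = (pr (g ⊗ₜ a) : K) *: k h.
Proof.
move=> kl; rewrite -linear_scale //.
have := pr_braidH (h ⊗ₜ (g ⊗ₜ a)); rewrite /comp !tmapE tunitrE => <-.
rewrite tleftE (@tsum_push _ _ _ _ _ (fun t =>
  k (tunitl ((pr \ox idfun) (tassocV ((idfun \ox Xi) t)))))); last by lin.
apply: eq_tsum => p q; rewrite tmapE.
expand (fun t => k (tunitl ((pr \ox idfun) (tassocV (idfun p ⊗ₜ t))))).
by apply: eq_tsum => a' q'; rewrite tassocVE tmapE tunitlE linear_scale.
Qed.

Lemma pairing_actE h a : pairing_act Xi pr (h ⊗ₜ a) =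
  \tsum_(a1, a2 <- coprod a) \tsum_(a', h' <- Xi (h ⊗ₜ a1))
    (pr (h' ⊗ₜ a2) : K) *: a'.
Proof.
rewrite /pairing_act [LHS]/= tmapE.
expand (fun t => tunitr ((idfun \ox pr) (tleft A Xi (h ⊗ₜ t)))).
apply: eq_tsum => a1 a2; rewrite tleftE !linear_tsum.
by apply: eq_tsum => a' h'; rewrite tmapE tunitrE.
Qed.

Lemma pairing1l a : pr (1 ⊗ₜ a) = counit a.
Proof.
have eP : linear (fun a => pr (1 ⊗ₜ a)) by lin.
have [e eE] := linear_pack eP.
(* Obtained from [h = h * 1]. For [h = 1] it is the convolution idempotency of the form [e]; for
   general [h] it shows that [pr] vanishes if [e] does. *)
have prE h b : pr (h ⊗ₜ b) =
    \tsum_(a1, a2 <- coprod b) (pr (h ⊗ₜ a1) : K) *: pr (1 ⊗ₜ a2).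
  rewrite -[h in LHS]mulr1 pairing_mullE; apply: eq_tsum => a1 a2.
  by rewrite (mutual1l XiP) tsum_pure //; lin.
have eM (b c : A) : pr (1 ⊗ₜ (b * c)) = (pr (1 ⊗ₜ b) : K) *: pr (1 ⊗ₜ c).
  rewrite pairing_mulrE coprod1 tsum_pure; last by lin.
  by rewrite (mutual1l XiP) tsum_pure //; lin.
(* By [eM] this value is idempotent in the field [K], hence 0 or 1. If it were 0, [eM] would kill
   the form [e], and then [prE] would kill all of [pr], against [pr_neq0]. *)
have e1 : pr (1 ⊗ₜ 1) = 1.
  have e1_idem : pr (1 ⊗ₜ 1) * pr (1 ⊗ₜ 1) = pr (1 ⊗ₜ 1) :> K.
    by have := eM 1 1; rewrite (mulr1 (1 : A)) => /esym.
  have [e10|e1_neq0] := eqVneq (pr (1 ⊗ₜ 1) : K) 0; last first.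
    by apply: (mulfI e1_neq0); rewrite mulr1.
  have [t] := pr_neq0; case/eqP.
  apply: (@tensor_ext _ _ _ _ pr \0) => h b; rewrite prE.
  (* The zero summand is written as a multiple by 0 so that [tsumZ] can pull the scalar out of the
     sum. *)
  rewrite (@eq_tsum _ _ _ _ _ _ (fun _ _ => 0 *: (0 : K^o))) => [|a1 a2].
    by rewrite -tsumZ scale0r.
  have -> : pr (1 ⊗ₜ a2) = 0.
    by have := eM 1 a2; rewrite mul1r e10 scale0r.
  by rewrite scale0r scaler0.
have -> : pr (1 ⊗ₜ a) = e a by rewrite eE.
by apply: idem_alg_form_counit => [|b c|b]; rewrite eE.
Qed.

Lemma pairing1r h : pr (h ⊗ₜ 1) = counit h.
Proof.
have fP : linear (fun h => pr (h ⊗ₜ 1)) by lin.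
have [f fE] := linear_pack fP.
have -> : pr (h ⊗ₜ 1) = f h by rewrite fE.
apply: idem_alg_form_counit => [|g k|g]; rewrite fE.
- by rewrite pairing1l counit1.
- rewrite pairing_mullE coprod1 tsum_pure; last by lin.
  by rewrite (mutual1r XiP) tsum_pure //; lin.
- rewrite -[1 in RHS]mulr1 pairing_mulrE; apply: eq_tsum => h1 h2.
  by rewrite (mutual1r XiP) tsum_pure //; lin.
Qed.

(** The coproduct of [a * b] introduces the braiding of [a2] with [b1]. The mixed Yang-Baxter
    equation moves one part of [h] past this braiding, and the extra hypothesis [pr_braidA] absorbs
    it. *)
Lemma pairing_act_mulr h a b :
  pairing_act Xi pr (h ⊗ₜ (a * b)) =
  \tsum_(h1, h2 <- coprod h) \tsum_(a', h' <- Xi (h2 ⊗ₜ a))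
    pairing_act Xi pr (h1 ⊗ₜ a') * pairing_act Xi pr (h' ⊗ₜ b).
Proof.
(* Form reached once the braiding is gone: [x] is paired with a transported [a2], and what remains
   of [y] with [b2]. *)
transitivity (\tsum_(a1, a2 <- coprod a) \tsum_(b1, b2 <- coprod b)
  \tsum_(a1', h1 <- Xi (h ⊗ₜ a1)) \tsum_(x, y <- coprod h1)
  \tsum_(a2', y1 <- Xi (y ⊗ₜ a2)) \tsum_(b1', y2 <- Xi (y1 ⊗ₜ b1))
  (pr (x ⊗ₜ a2') : K) *: ((pr (y2 ⊗ₜ b2) : K) *: (a1' * b1'))).
  rewrite pairing_actE (tsum_coprodM (@coprodM _ _)); last by lin.
  apply: eq_tsum => a1 a2; apply: eq_tsum => b1 b2.
  transitivity (\tsum_(a1', h1 <- Xi (h ⊗ₜ a1)) \tsum_(p, q <- braid (a2 ⊗ₜ b1))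
    \tsum_(p', h2 <- Xi (h1 ⊗ₜ p))
    (pr (h2 ⊗ₜ (q * b2)) : K) *: (a1' * p')).
    rewrite [RHS]exchange_tsum; apply: eq_tsum => p q.
    by rewrite (mutual_mulrE XiP) //; lin.
  apply: eq_tsum => a1' h1.
  transitivity (\tsum_(x, y <- coprod h1) \tsum_(p, q <- braid (a2 ⊗ₜ b1))
    \tsum_(p', y1 <- Xi (y ⊗ₜ p)) \tsum_(q', y2 <- Xi (y1 ⊗ₜ q))
    \tsum_(p'', x1 <- Xi (x ⊗ₜ p'))
    (pr (x1 ⊗ₜ q') : K) *: ((pr (y2 ⊗ₜ b2) : K) *: (a1' * p''))).
    rewrite [RHS]exchange_tsum; apply: eq_tsum => p q.
    (* Pairing with the product [q * b2] splits [h2]; the coproduct axiom for [Xi] then lets [h1] be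
       split before it crosses [p]. *)
    transitivity (\tsum_(p', h2 <- Xi (h1 ⊗ₜ p)) \tsum_(x, y <- coprod h2)
      \tsum_(q', y2 <- Xi (y ⊗ₜ q))
      (pr (x ⊗ₜ q') : K) *: ((pr (y2 ⊗ₜ b2) : K) *: (a1' * p'))).
      apply: eq_tsum => p' h2; rewrite pairing_mulrE.
      rewrite (@tsum_push _ _ _ _ _ (fun z : K^o => (z : K) *: (a1' * p')));
        last by lin.
      apply: eq_tsum => x y.
      rewrite (@tsum_push _ _ _ _ _ (fun z : K^o => (z : K) *: (a1' * p')));
        last by lin.
      by apply: eq_tsum => q' y2; rewrite scalerA.
    rewrite (mutual_coprodlE XiP _ _ (k := fun p' x y =>
      \tsum_(q', y2 <- Xi (y ⊗ₜ q))
      (pr (x ⊗ₜ q') : K) *: ((pr (y2 ⊗ₜ b2) : K) *: (a1' * p')))); last by lin.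
    by do 2 (apply: eq_tsum => ? ?); rewrite exchange_tsum.
  apply: eq_tsum => x y.
  (* With the strand [y] taken across first, the braiding faces only the strand [x], which is the
     shape required by [pairing_braidA]. *)
  rewrite (mutual_yang_baxterr XiP _ _ _ (k := fun p' q' y2 =>
    \tsum_(p'', x1 <- Xi (x ⊗ₜ p'))
    (pr (x1 ⊗ₜ q') : K) *: ((pr (y2 ⊗ₜ b2) : K) *: (a1' * p'')))); last by lin.
  apply: eq_tsum => a2' y1; apply: eq_tsum => b1' y2.
  by rewrite (pairing_braidA _ _ _ (k := fun c =>
    (pr (y2 ⊗ₜ b2) : K) *: (a1' * c))) //; lin.
(* The legs of [b] are gathered into an action, and [h] is split before any crossing instead of
   after crossing [a1]. *)
transitivity (\tsum_(a1, a2 <- coprod a) \tsum_(h1, h2 <- coprod h)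
  \tsum_(a1', y <- Xi (h2 ⊗ₜ a1)) \tsum_(a2', y1 <- Xi (y ⊗ₜ a2))
  (\tsum_(c, x <- Xi (h1 ⊗ₜ a1')) (pr (x ⊗ₜ a2') : K) *: c) *
  pairing_act Xi pr (y1 ⊗ₜ b)).
  apply: eq_tsum => a1 a2.
  transitivity (\tsum_(a1', h1 <- Xi (h ⊗ₜ a1)) \tsum_(x, y <- coprod h1)
    \tsum_(a2', y1 <- Xi (y ⊗ₜ a2))
    (pr (x ⊗ₜ a2') : K) *: (a1' * pairing_act Xi pr (y1 ⊗ₜ b))).
    rewrite exchange_tsum; apply: eq_tsum => a1' h1.
    rewrite exchange_tsum; apply: eq_tsum => x y.
    rewrite exchange_tsum; apply: eq_tsum => a2' y1.
    rewrite pairing_actE.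
    rewrite (@tsum_push _ _ _ _ _ (fun z => (pr (x ⊗ₜ a2') : K) *: (a1' * z)));
      last by lin.
    apply: eq_tsum => b1 b2.
    rewrite (@tsum_push _ _ _ _ _ (fun z => (pr (x ⊗ₜ a2') : K) *: (a1' * z)));
      last by lin.
    by apply: eq_tsum => b1' y2; rewrite -scalerAr.
  rewrite (mutual_coprodlE XiP _ _ (k := fun a1' x y =>
    \tsum_(a2', y1 <- Xi (y ⊗ₜ a2))
    (pr (x ⊗ₜ a2') : K) *: (a1' * pairing_act Xi pr (y1 ⊗ₜ b)))); last by lin.
  apply: eq_tsum => h1 h2; apply: eq_tsum => a1' y.
  rewrite exchange_tsum; apply: eq_tsum => a2' y1.
  rewrite (@tsum_push _ _ _ _ _ (fun z => z * pairing_act Xi pr (y1 ⊗ₜ b)));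
    last by lin.
  by apply: eq_tsum => c x; rewrite -scalerAl.
rewrite exchange_tsum; apply: eq_tsum => h1 h2.
(* The strand [h2] crosses [a1] and then [a2]; this is one crossing of [a] followed by the coproduct
   of the result. *)
rewrite -(mutual_coprodrE XiP _ _ (k := fun a1' a2' y1 =>
  (\tsum_(c, x <- Xi (h1 ⊗ₜ a1')) (pr (x ⊗ₜ a2') : K) *: c) *
  pairing_act Xi pr (y1 ⊗ₜ b))); last by lin.
apply: eq_tsum => a' h'; rewrite [in RHS]pairing_actE.
rewrite (@tsum_push _ _ _ _ _ (fun z => z * pairing_act Xi pr (h' ⊗ₜ b))) //.
by lin.
Qed.

(** Pairing with a product [h' * g'] splits the second leg of [a]. By coassociativity the first leg
    can be split instead, which is what two successive actions do. *)
Lemma pairing_act_mull h g a :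
  pairing_act Xi pr ((h * g) ⊗ₜ a) =
  pairing_act Xi pr (h ⊗ₜ pairing_act Xi pr (g ⊗ₜ a)).
Proof.
transitivity (\tsum_(a1, a2 <- coprod a) \tsum_(x, y <- coprod a2)
  \tsum_(a1', g' <- Xi (g ⊗ₜ a1)) \tsum_(x', g'' <- Xi (g' ⊗ₜ x))
  \tsum_(c, h' <- Xi (h ⊗ₜ a1'))
  (pr (g'' ⊗ₜ y) : K) *: ((pr (h' ⊗ₜ x') : K) *: c)).
  rewrite pairing_actE; apply: eq_tsum => a1 a2.
  rewrite (mutual_mullE XiP); last by lin.
  rewrite exchange_tsum; apply: eq_tsum => a1' g'.
  transitivity (\tsum_(c, h' <- Xi (h ⊗ₜ a1')) \tsum_(x, y <- coprod a2)
    \tsum_(x', g'' <- Xi (g' ⊗ₜ x))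
    (pr (g'' ⊗ₜ y) : K) *: ((pr (h' ⊗ₜ x') : K) *: c)).
    apply: eq_tsum => c h'; rewrite pairing_mullE.
    rewrite (@tsum_push _ _ _ _ _ (fun z : K^o => (z : K) *: c)); last by lin.
    apply: eq_tsum => x y.
    rewrite (@tsum_push _ _ _ _ _ (fun z : K^o => (z : K) *: c)); last by lin.
    by apply: eq_tsum => x' g''; rewrite !scalerA mulrC.
  rewrite exchange_tsum; apply: eq_tsum => x y.
  by rewrite exchange_tsum.
rewrite -(hopf_coprodA _ (k := fun a1 x y =>
  \tsum_(a1', g' <- Xi (g ⊗ₜ a1)) \tsum_(x', g'' <- Xi (g' ⊗ₜ x))
  \tsum_(c, h' <- Xi (h ⊗ₜ a1'))
  (pr (g'' ⊗ₜ y) : K) *: ((pr (h' ⊗ₜ x') : K) *: c))); last by lin.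
rewrite [pairing_act _ _ (g ⊗ₜ a)]pairing_actE.
rewrite (@tsum_push _ _ _ _ _ (fun z => pairing_act Xi pr (h ⊗ₜ z)));
  last by lin.
apply: eq_tsum => a1 a2.
rewrite (@tsum_push _ _ _ _ _ (fun z => pairing_act Xi pr (h ⊗ₜ z)));
  last by lin.
(* The element [g] has crossed both halves of the first leg; merging these crossings leaves a
   coproduct taken after the inner action, ready for the outer action of [h]. *)
rewrite -(mutual_coprodrE XiP _ _ (k := fun a1' x' g'' =>
  \tsum_(c, h' <- Xi (h ⊗ₜ a1'))
  (pr (g'' ⊗ₜ a2) : K) *: ((pr (h' ⊗ₜ x') : K) *: c))); last by lin.
apply: eq_tsum => a' g'.
rewrite (linear_scale (g := fun z => pairing_act Xi pr (h ⊗ₜ z))); last by lin.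
rewrite pairing_actE tsumZ; apply: eq_tsum => a1' x'.
by rewrite tsumZ.
Qed.

(** The hypothesis [pr_braidH], read backwards, trades a pairing beside the strand [h'] for a
    braiding of [h'] with [g']. The mixed Yang-Baxter equation then carries this braiding back to
    [h] and [g]. *)
Lemma pairing_act_braid h g a :
  Xi (h ⊗ₜ pairing_act Xi pr (g ⊗ₜ a)) =
  \tsum_(p, q <- braid (h ⊗ₜ g)) \tsum_(a', q' <- Xi (q ⊗ₜ a))
    pairing_act Xi pr (p ⊗ₜ a') ⊗ₜ q'.
Proof.
transitivity (\tsum_(a1, a2 <- coprod a) \tsum_(a', g' <- Xi (g ⊗ₜ a1))
  \tsum_(c, h' <- Xi (h ⊗ₜ a')) (pr (g' ⊗ₜ a2) : K) *: (c ⊗ₜ h')).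
  rewrite pairing_actE (@tsum_push _ _ _ _ _ (fun z => Xi (h ⊗ₜ z)));
    last by lin.
  apply: eq_tsum => a1 a2.
  rewrite (@tsum_push _ _ _ _ _ (fun z => Xi (h ⊗ₜ z))); last by lin.
  apply: eq_tsum => a' g'.
  rewrite (linear_scale (g := fun z => Xi (h ⊗ₜ z))); last by lin.
  by rewrite -tsumZ -tensorE.
transitivity (\tsum_(a1, a2 <- coprod a) \tsum_(p, q <- braid (h ⊗ₜ g))
  \tsum_(a1', q' <- Xi (q ⊗ₜ a1)) \tsum_(c, p' <- Xi (p ⊗ₜ a1'))
  \tsum_(a2', q'' <- Xi (q' ⊗ₜ a2)) (pr (p' ⊗ₜ a2') : K) *: (c ⊗ₜ q'')).
  apply: eq_tsum => a1 a2.
  (* Working on the right side, the braiding is moved past [a1], so that it acts on [h'] and [g']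
     directly before the pairing with [a2]. *)
  rewrite (mutual_yang_baxterl XiP _ _ _ (k := fun c p' q' =>
    \tsum_(a2', q'' <- Xi (q' ⊗ₜ a2)) (pr (p' ⊗ₜ a2') : K) *: (c ⊗ₜ q'')));
    last by lin.
  apply: eq_tsum => a' g'; apply: eq_tsum => c h'.
  by rewrite (pairing_braidH _ _ _ (k := fun z => c ⊗ₜ z)) //; lin.
rewrite exchange_tsum; apply: eq_tsum => p q.
under [RHS]eq_tsum => a' q'.
  rewrite pairing_actE (@tsum_push _ _ _ _ _ (fun z => z ⊗ₜ q')); last by lin.
  over.
rewrite (mutual_coprodrE XiP _ _ (k := fun a1 a2 q' =>
  (\tsum_(c, p' <- Xi (p ⊗ₜ a1)) (pr (p' ⊗ₜ a2) : K) *: c) ⊗ₜ q'));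
  last by lin.
do 2 (apply: eq_tsum => ? ?); rewrite exchange_tsum.
apply: eq_tsum => a2' q''.
rewrite (@tsum_push _ _ _ _ _ (fun z => z ⊗ₜ q'')); last by lin.
by apply: eq_tsum => c p'; rewrite linearZl_LR.
Qed.

End PairingAction.

(** * The module algebra axioms, checked on pure tensors *)

Theorem theorem2p5 (K : fieldType) (H A : braidedHopfType K)
    (Xi : {linear H ⊗ A -> A ⊗ H}) (pr : {linear H ⊗ A -> K^o})
    (Xi_braiding : mutual_braiding Xi)
    (pr_pairing : braided_pairing Xi pr)
    (pr_neq0 : exists t : H ⊗ A, pr t != 0)
    (pr_braidA :
      tunitr \o (@idfun A \ox pr) \o tleft A Xi \o (@idfun H \ox braid)
        =1 tunitl \o (pr \ox @idfun A) \o tassocV)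
    (pr_braidH :
      tunitl \o (pr \ox @idfun H) \o tassocV \o (@idfun H \ox Xi)
          \o tleft A braid
        =1 tunitr \o (@idfun H \ox pr)) :
  braided_module_algebra (pairing_act Xi pr) Xi.
Proof.
split.
- exact: mutual_bij Xi_braiding.
- exact: mutual_mull Xi_braiding.
- exact: mutual_mulr Xi_braiding.
- exact: mutual_coprodl Xi_braiding.
- apply: tensor_ext3 => [||h a b]; [exact: linearP | exact: linearP | ].
  rewrite /comp !tmapE tmulE pairing_act_mulr //.
  set act := pairing_act Xi pr.
  expand (fun t => tmul ((act \ox act) (tmid H A Xi (t ⊗ₜ (a ⊗ₜ b))))).
  apply: eq_tsum => h1 h2; rewrite tmidE !linear_tsum.
  by apply: eq_tsum => a' h'; rewrite tmapE tmulE.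
- apply: tensor_ext3 => [||h g a]; [exact: linearP | exact: linearP | ].
  by rewrite /comp tassocVE !tmapE tmulE pairing_act_mull.
- apply: tensor_ext3 => [||h g a]; [exact: linearP | exact: linearP | ].
  rewrite /comp tmapE [LHS]pairing_act_braid // tleftE.
  set act := pairing_act Xi pr.
  rewrite (@tsum_push _ _ _ _ _ (fun t =>
    (act \ox @idfun H) (tassocV ((idfun \ox Xi) t)))); last by lin.
  apply: eq_tsum => p q; rewrite tmapE.
  expand (fun t => (act \ox @idfun H) (tassocV (idfun p ⊗ₜ t))).
  by apply: eq_tsum => a' q'; rewrite tassocVE tmapE.
- move=> a; rewrite pairing_actE.
  under eq_tsum => a1 a2 do [rewrite (mutual1l Xi_braiding) tsum_pure; last by lin].
  under eq_tsum => a1 a2 do rewrite (pairing1l Xi_braiding pr_pairing pr_neq0).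
  by rewrite (hopf_counitr _ (k := id)).
- move=> h; rewrite pairing_actE coprod1 tsum_pure; last by lin.
  rewrite (mutual1r Xi_braiding) tsum_pure; last by lin.
  by rewrite (pairing1r Xi_braiding pr_pairing pr_neq0).
Qed.
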